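(* Let $(M,\eta,\omega)$ be a compact connected cosymplectic manifold. Let $\Phi_F$ be a co-Hamiltonian isotopy, and let $\epsilon$ be a positive real number. Then there exists a boundary flat co-Hamiltonian isotopy $\Psi_H$ such that 1. $\Phi_F^0=\Psi_H^0$ and $\Phi_F^1=\Psi_H^1$ (equality of the time-$0$ maps and of the time-$1$ maps), 2. $D_{CH}^{(1,\infty)}(\Phi_F,\Psi_H)<\epsilon$, and 3. $\bar d(\Psi_H,\Phi_F)<\epsilon$.
   Context: A cosymplectic structure on a smooth manifold $M$ is a pair $(\eta,\omega)$ of a closed $1$-form $\eta$ and a closed $2$-form $\omega$ such that for each $x\in M$ the linear map $T_xM\to T_x^\ast M$, $Y\mapsto \iota(Y)\omega_x+\eta_x(Y)\eta_x$ is a bijection. For a vector field $X$ put $I_{\eta,\omega}(X):=\iota(X)\omega+\eta(X)\eta$. A cosymplectic isotopy is a smooth isotopy $\Phi=\{\phi_t\}_{t\in[0,1]}$ of $M$, $\phi_0=id_M$, with $\phi_t^\ast\eta=\eta$ and $\phi_t^\ast\omega=\omega$ for each $t$; $\dot\phi_t$ denotes the vector field $\frac{d\phi_t}{dt}\circ\phi_t^{-1}$. It is co-Hamiltonian if $I_{\eta,\omega}(\dot\phi_t)$ is exact for each $t$; one writes $\Phi_F$ when $I_{\eta,\omega}(\dot\phi_t)=dF_t$ with $F:(t,x)\mapsto F_t(x)$ a smooth function on $[0,1]\times M$. A co-Hamiltonian isotopy $\Phi_F$ is boundary flat if there exists $\delta\in\,]0,1[$ such that $F_t=0$ for all $t\in[0,\delta[\,\cup\,]1-\delta,1]$.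 $C(\Phi,\eta)^t$ denotes the function $x\mapsto\eta(\dot\phi_t)(\phi_t(x))$; for cosymplectic isotopies it is constant on $M$ for each $t$ and is identified with its constant value. For a function $f$ on $M$, $osc(f)=\max_Mf-\min_Mf$. For co-Hamiltonian isotopies $\Phi_F,\Psi_H$, $$D_{CH}^{(1,\infty)}(\Phi_F,\Psi_H)=\int_0^1\left(osc(F_t-H_t)+|C(\Phi_F,\eta)^t-C(\Psi_H,\eta)^t|\right)dt.$$ With $d$ the distance on $M$ (induced by a fixed Riemannian metric), for homeomorphisms $f,h$ of $M$ put $d_{C^0}(f,h)=\sup_{x\in M}d(f(x),h(x))$ and $d_0(f,h)=\max(d_{C^0}(f,h),d_{C^0}(f^{-1},h^{-1}))$; for continuous paths $\lambda,\mu$ of homeomorphisms starting at $id_M$, $\bar d(\lambda,\mu)=\max_{t\in[0,1]}d_0(\lambda(t),\mu(t))$. *)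

(* Defs.v *)
From HB Require Import structures.
From mathcomp Require Import all_boot all_order all_algebra.
From mathcomp Require Import all_classical all_reals all_analysis.

Set Implicit Arguments.
Unset Strict Implicit.
Unset Printing Implicit Defensive.

Import Order.TTheory GRing.Theory Num.Theory.
Import numFieldNormedType.Exports.
Local Open Scope classical_set_scope.
Local Open Scope ring_scope.

Section Smoothness.
Context {R : realType}.

(* Used with V finite-dimensional, where this is the usual class C^k on an
   open set U. *)
Fixpoint Ck {V W : normedModType R} (k : nat) (U : set V) (f : V -> W) : Prop :=
  (forall x, U x -> {for x, continuous f}) /\
  if k is k'.+1 then
    forall v : V,
      (forall x, U x -> derivable f x v) /\ Ck k' U (fun x => 'D_v f x)
  else True.

Definition Cinfty {V W : normedModType R} (U : set V) (f : V -> W) : Prop :=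
  forall k, Ck k U f.

(* Smoothness on an arbitrary subset S (a closed interval, a product
   [0,1] x open, ...): f has a smooth extension near each point of S. *)
Definition smooth_on {V W : normedModType R} (S : set V) (f : V -> W) : Prop :=
  forall p, S p -> exists U G,
    [/\ open U, U p, @Cinfty V W U G & forall q, U q -> S q -> f q = G q].

End Smoothness.

Record chart (R : realType) (n : nat) (M : Type) := Chart {
  dom : set M;
  coords : M -> 'rV[R]_n;
  param : 'rV[R]_n -> M (* the inverse of coords; arbitrary off the image *) }.

Definition image_of {R : realType} {n : nat} {M : Type} (c : chart R n M) :
  set 'rV[R]_n := coords c @` dom c.

(* A smooth structure, without boundary, given by a not necessarily maximal
   atlas. *)
Record smooth_manifold (R : realType) (n : nat) (M : ptopologicalType) :=
  SmoothManifold {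
  atlas : set (chart R n M);
  manifold_hausdorff : hausdorff_space M;
  manifold_second_countable : @second_countable M;
  dom_open : forall c, atlas c -> open (dom c);
  image_open : forall c, atlas c -> open (image_of c);
  coordsK : forall c, atlas c -> {in dom c, cancel (coords c) (param c)};
  coords_continuous : forall c, atlas c ->
    forall x, dom c x -> {for x, continuous (coords c)};
  param_continuous : forall c, atlas c ->
    forall u, image_of c u -> {for u, continuous (param c)};
  atlas_cover : forall x, exists2 c, atlas c & dom c x;
  transition_smooth : forall c c', atlas c -> atlas c' ->
    Cinfty (coords c @` (dom c `&` dom c')) (coords c' \o param c) }.

Section Manifold.
Context {R : realType} {n : nat} {M : ptopologicalType}.
Variable X : smooth_manifold R n M.

Definition smooth_fun (f : M -> R) : Prop :=
  forall c, atlas X c -> Cinfty (image_of c) (f \o param c).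

Definition smooth_into {V : normedModType R} (S : set V) (f : V -> M) : Prop :=
  forall p c, S p -> atlas X c -> dom c (f p) -> exists U G,
    [/\ open U, U p, @Cinfty R V 'rV[R]_n U G &
        forall q, U q -> S q -> dom c (f q) /\ coords c (f q) = G q].

Definition smooth_map (f : M -> M) : Prop :=
  forall c, atlas X c -> smooth_into (image_of c) (f \o param c).

Definition diffeo (f : M -> M) : Prop :=
  smooth_map f /\
  exists g, [/\ smooth_map g, cancel f g & cancel g f].

(* Time-dependent objects are indexed by t : R, but only their values at
   t in [0,1] are meaningful. *)
Definition smooth_fun_path (F : R -> M -> R) : Prop :=
  forall c, atlas X c ->
    @smooth_on R (R * 'rV[R]_n)%type R (`[0, 1] `*` image_of c)
      (fun p => F p.1 (param c p.2)).

Definition smooth_map_path (phi : R -> M -> M) : Prop :=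
  forall c, atlas X c ->
    @smooth_into (R * 'rV[R]_n)%type (`[0, 1] `*` image_of c)
      (fun p => phi p.1 (param c p.2)).

(* Tangent vectors are derivations of the algebra of smooth functions.
   They are encoded as operators on all functions M -> R that vanish on
   non-smooth ones, so that two tangent vectors are equal as soon as they
   agree on smooth functions. *)
Definition operator : Type := (M -> R) -> R.

Definition on_smooth (D : operator) : operator :=
  fun f => if `[< smooth_fun f >] then D f else 0.

Definition tangent (x : M) : set operator :=
  [set D | [/\ on_smooth D = D,
     forall (a : R) f g, smooth_fun f -> smooth_fun g ->
       D (fun y => a * f y + g y) = a * D f + D g &
     forall f g, smooth_fun f -> smooth_fun g ->
       D (fun y => f y * g y) = f x * D g + g x * D f]].

Definition coord_vector (c : chart R n M) (i : 'I_n) (x : M) : operator :=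
  on_smooth (fun f => 'D_(delta_mx 0 i) (f \o param c) (coords c x)).

Definition pushforward (f : M -> M) (D : operator) : operator :=
  on_smooth (fun h => D (h \o f)).

(* The derivative of h at t relative to I, hence one-sided at the end points
   of a closed interval. *)
Definition derive_in (I : set R) (h : R -> R) (t : R) : R :=
  lim ((fun s => (h s - h t) / (s - t)) @ within I t^').

Definition velocity (I : set R) (gam : R -> M) (t : R) : operator :=
  on_smooth (fun f => derive_in I (f \o gam) t).

Definition linear_on (x : M) (alpha : operator -> R) : Prop :=
  forall (a : R) Y Z, tangent x Y -> tangent x Z ->
    alpha (fun f => a * Y f + Z f) = a * alpha Y + alpha Z.

Definition bilinear_on (x : M) (b : operator -> operator -> R) : Prop :=
  forall Y, tangent x Y -> linear_on x (b Y) /\ linear_on x (b ^~ Y).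

Definition coef1 (eta : M -> operator -> R) (c : chart R n M) (i : 'I_n)
  (u : 'rV[R]_n) : R :=
  eta (param c u) (coord_vector c i (param c u)).

Definition coef2 (b : M -> operator -> operator -> R) (c : chart R n M)
  (i j : 'I_n) (u : 'rV[R]_n) : R :=
  b (param c u) (coord_vector c i (param c u)) (coord_vector c j (param c u)).

Definition one_form (eta : M -> operator -> R) : Prop :=
  (forall x, linear_on x (eta x)) /\
  forall c i, atlas X c -> Cinfty (image_of c) (coef1 eta c i).

Definition smooth_2tensor (b : M -> operator -> operator -> R) : Prop :=
  (forall x, bilinear_on x (b x)) /\
  forall c i j, atlas X c -> Cinfty (image_of c) (coef2 b c i j).

Definition two_form (omega : M -> operator -> operator -> R) : Prop :=
  smooth_2tensor omega /\
  forall x Y, tangent x Y -> omega x Y Y = 0.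

Definition riemannian_metric (g : M -> operator -> operator -> R) : Prop :=
  [/\ smooth_2tensor g,
    forall x Y Z, tangent x Y -> tangent x Z -> g x Y Z = g x Z Y &
    forall x Y, tangent x Y -> Y <> (fun=> 0) -> 0 < g x Y Y].

(* The coefficients of the exterior derivatives in the coordinates of c. *)
Definition ext_d1 (eta : M -> operator -> R) (c : chart R n M) (i j : 'I_n)
  (u : 'rV[R]_n) : R :=
  'D_(delta_mx 0 i) (coef1 eta c j) u - 'D_(delta_mx 0 j) (coef1 eta c i) u.

Definition ext_d2 (omega : M -> operator -> operator -> R) (c : chart R n M)
  (i j k : 'I_n) (u : 'rV[R]_n) : R :=
  'D_(delta_mx 0 i) (coef2 omega c j k) u
  - 'D_(delta_mx 0 j) (coef2 omega c i k) u
  + 'D_(delta_mx 0 k) (coef2 omega c i j) u.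

Definition closed1 (eta : M -> operator -> R) : Prop :=
  forall c i j u, atlas X c -> image_of c u -> ext_d1 eta c i j u = 0.

Definition closed2 (omega : M -> operator -> operator -> R) : Prop :=
  forall c i j k u, atlas X c -> image_of c u -> ext_d2 omega c i j k u = 0.

Definition preserves1 (f : M -> M) (eta : M -> operator -> R) : Prop :=
  forall x Y, tangent x Y -> eta (f x) (pushforward f Y) = eta x Y.

Definition preserves2 (f : M -> M) (omega : M -> operator -> operator -> R) :
  Prop :=
  forall x Y Z, tangent x Y -> tangent x Z ->
    omega (f x) (pushforward f Y) (pushforward f Z) = omega x Y Z.

Definition differential (f : M -> R) (Y : operator) : R := Y f.

Definition I_map (eta : M -> operator -> R)
  (omega : M -> operator -> operator -> R) (x : M) (Y Z : operator) : R :=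
  omega x Y Z + eta x Y * eta x Z.

(* The last clause is bijectivity of I_map from the tangent space at x to its
   dual, a covector being a linear functional restricted to the tangent space. *)
Definition cosymplectic (eta : M -> operator -> R)
  (omega : M -> operator -> operator -> R) : Prop :=
  [/\ one_form eta /\ closed1 eta, two_form omega /\ closed2 omega &
    forall x alpha, linear_on x alpha -> exists! Y, tangent x Y /\
      forall Z, tangent x Z -> I_map eta omega x Y Z = alpha Z].

Definition inverse (f : M -> M) (y : M) : M := get [set x | f x = y].

Definition path_velocity (phi : R -> M -> M) (t : R) (y : M) : operator :=
  velocity `[0, 1] (fun s => phi s (inverse (phi t) y)) t.

Definition cosymplectic_isotopy (eta : M -> operator -> R)
  (omega : M -> operator -> operator -> R) (phi : R -> M -> M) : Prop :=
  [/\ smooth_map_path phi, phi 0 = id &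
    forall t, 0 <= t <= 1 ->
      [/\ diffeo (phi t), preserves1 (phi t) eta & preserves2 (phi t) omega]].

Definition coHamiltonian (eta : M -> operator -> R)
  (omega : M -> operator -> operator -> R)
  (phi : R -> M -> M) (F : R -> M -> R) : Prop :=
  [/\ cosymplectic_isotopy eta omega phi, smooth_fun_path F &
    forall t y Z, 0 <= t <= 1 -> tangent y Z ->
      I_map eta omega y (path_velocity phi t y) Z = differential (F t) Z].

Definition boundary_flat (F : R -> M -> R) : Prop :=
  exists delta : R, 0 < delta < 1 /\
    forall t x, (t \in `[0, delta[) || (t \in `]1 - delta, 1]) -> F t x = 0.

Definition C_fun (eta : M -> operator -> R) (phi : R -> M -> M) (t : R)
  (x : M) : R :=
  eta (phi t x) (path_velocity phi t (phi t x)).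

(* C_fun eta phi t is constant for a cosymplectic isotopy phi of a connected
   M; its constant value is read off at the distinguished point of M. *)
Definition C_value (eta : M -> operator -> R) (phi : R -> M -> M) (t : R) : R :=
  C_fun eta phi t point.

Definition osc (f : M -> R) : R := sup (range f) - inf (range f).

Definition D_CH (eta : M -> operator -> R)
  (phi : R -> M -> M) (F : R -> M -> R)
  (psi : R -> M -> M) (H : R -> M -> R) : \bar R :=
  \int[lebesgue_measure]_(t in `[0, 1])
    (osc (fun x => F t x - H t x)
     + `|C_value eta phi t - C_value eta psi t|)%:E.

Definition piecewise_smooth (gam : R -> M) : Prop :=
  exists s : seq R, [/\ path <%R 0 s, last 0 s = 1 &
    forall i, (i < size s)%N ->
      smooth_into `[nth 0 (0 :: s) i, nth 0 s i] gam].

Definition curve_length (g : M -> operator -> operator -> R) (gam : R -> M) :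
  \bar R :=
  \int[lebesgue_measure]_(t in `[0, 1])
    (Num.sqrt (g (gam t) (velocity `[0, 1] gam t) (velocity `[0, 1] gam t)))%:E.

Definition dist (g : M -> operator -> operator -> R) (x y : M) : \bar R :=
  ereal_inf [set curve_length g gam | gam in
    [set gam | [/\ piecewise_smooth gam, gam 0 = x & gam 1 = y]]].

Definition d_C0 (g : M -> operator -> operator -> R) (f h : M -> M) : \bar R :=
  ereal_sup (range (fun x => dist g (f x) (h x))).

Definition d_0 (g : M -> operator -> operator -> R) (f h : M -> M) : \bar R :=
  maxe (d_C0 g f h) (d_C0 g (inverse f) (inverse h)).

Definition d_bar (g : M -> operator -> operator -> R)
  (lam mu : R -> M -> M) : \bar R :=
  ereal_sup [set d_0 g (lam t) (mu t) | t in `[0, 1]].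

End Manifold.

(* Main.v *)
Require Import Defs.
From mathcomp Require Import all_boot all_order all_algebra.
From mathcomp Require Import all_classical all_reals all_analysis.
From mathcomp Require Import measurable_realfun.
From mathcomp Require Import ring lra.

(** Slow the isotopy down near the two ends of the time interval.  If [zeta] is
    a smooth map of the unit interval to itself, then [psi t := phi (zeta t)]
    is again a path of cosymplectic diffeomorphisms, and its velocity at time
    [t] is [zeta' t] times the velocity of [phi] at time [zeta t].  As
    [I_map] is linear in its first tangent argument, [psi] is co-Hamiltonian
    with Hamiltonian [H t := zeta' t * F (zeta t)].  If [zeta] is constant near
    0 and near 1, with values 0 and 1, then [H] vanishes there and [psi] has
    the end points of [phi].

    Closeness asks for one estimate on [zeta] ([smooth_reparametrization]):
    for every small [delta], [zeta] can be chosen with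
    [|zeta t - t| <= 2 * delta], with [zeta' = 1] outside the two intervals of
    length [2 * delta] at the ends, and with [|zeta'| <= K] for a constant [K]
    which does not depend on [delta].  The functions [F] and
    [t |-> C_value phi t] are continuous on the compact sets where they live,
    hence bounded and uniformly continuous in time.  The integrand of the
    Hofer-like distance is thus small in the middle and bounded near the ends,
    so that its integral is small ([D_CH_reparam_lt]).

    For the uniform distance, every point of [M] has a neighbourhood any two
    points of which are joined by a short curve, a segment in a chart
    ([dist_small]).  Since [phi] and its pointwise inverse are jointly
    continuous on a compact space, nearby times then give uniformly close maps
    ([d_bar_reparam_le]).

    All computations with velocities go through [velocity_coords], which
    expresses a velocity in the coordinate frame of a chart.  It rests on the
    chain rule for maps with continuous directional derivatives
    ([is_derive_comp_C1]). *)

Set Implicit Arguments.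
Unset Strict Implicit.
Unset Printing Implicit Defensive.

Import Order.TTheory GRing.Theory Num.Theory.
Import numFieldNormedType.Exports.
Local Open Scope classical_set_scope.
Local Open Scope ring_scope.

(** * Calculus of maps between finite-dimensional normed spaces *)

Section Calculus.
Context {R : realType}.
Implicit Types V W : normedModType R.

Definition continuous_linear V W (L : V -> W) : Prop :=
  linear L /\ continuous L.

Lemma clinear0 V W (L : V -> W) : continuous_linear L -> L 0 = 0.
Proof.
move=> [lL _]; have := lL (-1) 0 0.
by rewrite scaler0 add0r scaleN1r addNr.
Qed.

Lemma clinearZ V W (L : V -> W) (c : R) v : continuous_linear L ->
  L (c *: v) = c *: L v.
Proof.
by move=> cL; have [lL _] := cL; rewrite -[c *: v]addr0 lL (clinear0 cL) addr0.
Qed.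

Lemma clinearB V W (L : V -> W) u v : continuous_linear L ->
  L (u - v) = L u - L v.
Proof. by move=> [lL _]; rewrite addrC -scaleN1r lL scaleN1r addrC. Qed.

(** Finite dimension, as the existence of a basis whose coordinate forms are
    continuous.  Row vectors, the reals and products of such spaces all have
    one. *)
Definition has_coords V : Prop :=
  exists m (e : 'I_m -> V) (a : 'I_m -> V -> R),
    (forall i, continuous_linear (a i)) /\ forall v, v = \sum_i a i v *: e i.

Lemma is_derive_line V W (f : V -> W) (x v : V) (s : R) d :
  is_derive (s *: v + x) v f d -> is_derive s 1 (fun r => f (r *: v + x)) d.
Proof.
have E : (fun h : R => h^-1 *: (f ((h *: 1 + s) *: v + x) - f (s *: v + x))) =
    (fun h : R => h^-1 *: (f (h *: v + (s *: v + x)) - f (s *: v + x))).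
  by apply/funext => h; rewrite [h *: 1]mulr1 scalerDl addrA.
by case=> fd <-; split; rewrite /derivable /derive /= E.
Qed.

Lemma increment_mvt V (f : V -> R) (x e : V) (b : R) :
  (forall c : R, `|c| <= `|b| -> derivable f (c *: e + x) e) ->
  exists c : R, `|c| <= `|b| /\
    f (b *: e + x) - f x = b * 'D_e f (c *: e + x).
Proof.
move=> df.
have dg (c : R) : `|c| <= `|b| ->
    is_derive c 1 (fun r => f (r *: e + x)) ('D_e f (c *: e + x)).
  by move=> cb; apply: is_derive_line; apply: derivableP; exact: df.
have cg (u v : R) : (forall c, c \in `[u, v] -> `|c| <= `|b|) ->
    {within `[u, v], continuous (fun r => f (r *: e + x))}.
  move=> uv; apply: derivable_within_continuous => c cuv.
  by have [] := dg c (uv _ cuv).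
have [b0|b0] := leP 0 b.
  have ab c : c \in `[0, b] -> `|c| <= `|b|.
    by rewrite in_itv/= => /andP[c0 cb]; rewrite !ger0_norm.
  have [c cb E] := MVT_segment b0
    (fun c cb => dg c (ab c (subset_itv_oo_cc cb))) (cg 0 b ab).
  exists c; split; first exact: ab.
  by move: E; rewrite scale0r add0r subr0 mulrC => ->.
have ab c : c \in `[b, 0] -> `|c| <= `|b|.
  by rewrite in_itv/= => /andP[c0 cb]; rewrite !ler0_norm ?lerN2// ltW.
have [c cb E] := MVT_segment (ltW b0)
  (fun c cb => dg c (ab c (subset_itv_oo_cc cb))) (cg b 0 ab).
exists c; split; first exact: ab.
by apply: oppr_inj; move: E; rewrite scale0r add0r sub0r mulrN opprB mulrC => ->.
Qed.

(** One coordinate step of the chain rule: by the mean value theorem the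
    increment of [f] along [e] is [b i] times a directional derivative taken at
    a point that tends to [x]. *)
Lemma increment_cvg V I (F : set_system I) {FF : Filter F} (f : V -> R)
    (x e : V) (y : I -> V) (b c : I -> R) (beta : R) :
  (\forall z \near x, derivable f z e) ->
  {for x, continuous (fun z => 'D_e f z)} ->
  y @ F --> x -> b @ F --> 0 -> (fun i => c i * b i) @ F --> beta ->
  (fun i => c i * (f (b i *: e + y i) - f (y i))) @ F --> beta * 'D_e f x.
Proof.
move=> /nbhs_ballP[r r0 df] cf yx b0 cb.
have /choice[t tP] i : exists t : R, `|t| <= `|b i| /\
    ((forall c : R, `|c| <= `|b i| -> ball x r (c *: e + y i)) ->
    f (b i *: e + y i) - f (y i) = b i * 'D_e f (t *: e + y i)).
  have [h|h] := pselect (forall c : R, `|c| <= `|b i| -> ball x r (c *: e + y i)).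
    have [|t [tb E]] := @increment_mvt V f (y i) e (b i); last by exists t.
    by move=> k /h/df.
  by exists 0; rewrite normr0.
have t0 : t @ F --> 0.
  apply/cvgr0Pnorm_le => eps eps0.
  move/cvgr0Pnorm_le : b0 => /(_ _ eps0); apply: filterS => i.
  by apply: le_trans; case: (tP i).
have zx : (fun i => t i *: e + y i) @ F --> x.
  rewrite -[x in _ --> x]add0r -(scale0r e).
  by apply: cvgD => //; apply: cvgZr_tmp.
have lim : (fun i => (c i * b i) * 'D_e f (t i *: e + y i)) @ F -->
    beta * 'D_e f x.
  apply: cvgM => //; exact: (cvg_comp _ _ zx cf).
apply: cvg_trans lim; apply: near_eq_cvg.
have be0 : (fun i => `|b i| * `|e|) @ F --> 0.
  have -> : (0 : R) = `|0 : R| * `|e| by rewrite normr0 mul0r.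
  apply: cvgM; last exact: cvg_cst.
  exact: cvg_norm.
have r20 : 0 < r / 2 by rewrite divr_gt0.
near=> i.
have [_ ->] := tP i; first by rewrite mulrA.
move=> k kb; rewrite -ball_normE /ball_/= [r]splitr.
rewrite opprD addrCA (le_lt_trans (ler_normD _ _))// ler_ltD//.
  rewrite normrN normrZ.
  apply: (@le_trans _ _ (`|b i| * `|e|)); first by rewrite ler_wpM2r.
  apply: le_trans (ler_norm _) _.
  by near: i; move/cvgr0Pnorm_le : be0; apply.
by near: i; move/cvgrPdist_lt : yx; apply.
Unshelve. all: by end_near. Qed.

Definition C1_at V W (f : V -> W) (x : V) : Prop := forall v,
  (\forall z \near x, derivable f z v) /\
  {for x, continuous (fun z => 'D_v f z)}.

Section Chain.
Context {V : normedModType R} {m : nat}.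
Variables (e : 'I_m -> V) (a : 'I_m -> V -> R).
Hypothesis a_lin : forall i, continuous_linear (a i).
Hypothesis ea : forall v, v = \sum_i a i v *: e i.

(** Going from [x] to [y i] one coordinate at a time splits the increment of [f]
    into increments in the directions of the basis, so that only directional
    derivatives matter. *)
Lemma chain_cvg I (F : set_system I) {FF : Filter F} (f : V -> R) (x w : V)
    (y : I -> V) (c : I -> R) : C1_at f x ->
  y @ F --> x -> (fun i => c i *: (y i - x)) @ F --> w ->
  (fun i => c i * (f (y i) - f x)) @ F --> \sum_i a i w * 'D_(e i) f x.
Proof.
move=> f1 yx yw.
have y0 : (fun i => y i - x) @ F --> 0.
  by rewrite -(subrr x); apply: cvgB => //; exact: cvg_cst.
pose p r i := \sum_(j <- r) a j (y i - x) *: e j + x.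
have ayx j : (fun i => a j (y i - x)) @ F --> (0 : R).
  have -> : (0 : R) = a j 0 by rewrite clinear0.
  by apply: (cvg_comp _ (a j)); [exact: y0|exact: (a_lin j).2].
have cay j : (fun i => c i * a j (y i - x)) @ F --> (a j w : R).
  have -> : (fun i => c i * a j (y i - x)) = (fun i => a j (c i *: (y i - x))).
    by apply/funext => i; rewrite clinearZ.
  by apply: (cvg_comp _ (a j)); [exact: yw|exact: (a_lin j).2].
(* [p r i] is [x] with the coordinates listed in [r] moved to those of [y i] *)
have main r : p r @ F --> x /\
    (fun i => c i * (f (p r i) - f x)) @ F -->
      \sum_(j <- r) a j w * 'D_(e j) f x.
  elim: r => [|j r [px IH]].
    have -> : p [::] = cst x by apply/funext => i; rewrite /p big_nil add0r.
    split; first exact: cvg_cst.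
    by rewrite big_nil; under eq_fun do rewrite subrr mulr0; exact: cvg_cst.
  have pE i : p (j :: r) i = a j (y i - x) *: e j + p r i.
    by rewrite /p big_cons addrA.
  split.
    have -> : p (j :: r) = (fun i => a j (y i - x) *: e j + p r i).
      by apply/funext => i; exact: pE.
    rewrite -[x in _ --> x]add0r -(scale0r (e j)).
    by apply: cvgD => //; apply: cvgZr_tmp.
  under eq_fun => i do rewrite pE -[X in c i * X](subrKA (f (p r i))) mulrDr.
  rewrite big_cons; apply: cvgD IH.
  by have [? ?] := f1 (e j); apply: increment_cvg.
have [_] := main (index_enum 'I_m).
suff -> : p (index_enum 'I_m) = y by [].
by apply/funext => i; rewrite /p -ea subrK.
Qed.

Lemma derive_coords (f : V -> R) (x w : V) : C1_at f x ->
  is_derive x w f (\sum_i a i w * 'D_(e i) f x).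
Proof.
move=> f1.
have lim : (fun h : R => h^-1 * (f (h *: w + x) - f x)) @ 0^' -->
    \sum_i a i w * 'D_(e i) f x.
  apply: chain_cvg => //.
    rewrite -[x in _ --> x]add0r -(scale0r w).
    apply: cvgD; last exact: cvg_cst.
    by apply: cvgZr_tmp; exact: cvg_within.
  apply: (@cvg_trans _ (cst w @ 0^')); last exact: cvg_cst.
  apply: near_eq_cvg; near=> h.
  by rewrite addrK scalerA mulVf ?scale1r//; near: h; exact: nbhs_dnbhs_neq.
split; first by apply/cvg_ex; eexists; exact: lim.
by rewrite /derive; apply: cvg_lim; [exact: norm_hausdorff|exact: lim].
Unshelve. all: by end_near. Qed.
End Chain.

(** The chain rule in one direction.  It fails for a function that only has
    directional derivatives; their continuity, through [chain_cvg], is what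
    makes it hold. *)
Lemma is_derive_comp_C1 V V' (f : V -> R) (g : V' -> V) (y v : V') (w : V) :
  has_coords V -> C1_at f (g y) -> is_derive y v g w ->
  is_derive y v (f \o g) ('D_w f (g y)).
Proof.
move=> [m [e [a [ac ea]]]] f1 [dg dgE].
have gw : (fun h : R => h^-1 *: (g (h *: v + y) - g y)) @ 0^' --> w.
  by rewrite -dgE; exact: dg.
have gy : (fun h : R => g (h *: v + y)) @ 0^' --> g y.
  (* a directional derivative forces continuity along the line *)
  have : (fun h : R => h *: (h^-1 *: (g (h *: v + y) - g y)) + g y) @ 0^' -->
      0 *: w + g y.
    apply: cvgD; last exact: cvg_cst.
    by apply: cvgZ => //; exact: cvg_within.
  rewrite scale0r add0r; apply: cvg_trans; apply: near_eq_cvg; near=> h.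
  rewrite scalerA mulfV ?scale1r ?subrK//; near: h; exact: nbhs_dnbhs_neq.
have [_ ->] := derive_coords ac ea w f1.
have lim := chain_cvg ac ea f1 gy gw.
split; first by apply/cvg_ex; eexists; exact: lim.
by rewrite /derive; apply: cvg_lim; [exact: norm_hausdorff|exact: lim].
Unshelve. all: by end_near. Qed.

Lemma is_derive1_comp_vect (W : normedModType R) (f : R -> W) (g : R -> R)
    (x : R) a b : is_derive (g x) 1 f a -> is_derive x 1 g b ->
  is_derive x 1 (f \o g) (b *: a).
Proof.
move=> [/derivable1_diffP df <-] [/derivable1_diffP dg <-].
have dfg := differentiable_comp dg df.
split; first exact: diff_derivable.
have Eg : 'D_1 g x = 'd g x 1 by exact: deriveE.
have Ef : 'D_1 f (g x) = 'd f (g x) 1 by exact: deriveE.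
have Efg : 'D_1 (f \o g) x = 'd (f \o g) x 1 by exact: deriveE.
have Ed : 'd (f \o g) x 1 = 'd f (g x) ('d g x 1).
  exact: (congr1 (fun h => h 1) (diff_comp dg df)).
have El : 'd f (g x) ('d g x 1) = 'd g x 1 *: 'd f (g x) 1.
  by rewrite -[in LHS](mulr1 ('d g x 1)) [LHS]linearZ.
apply: (etrans Efg); apply: (etrans Ed); apply: (etrans El).
by congr (_ *: _); [exact: esym Eg|exact: esym Ef].
Qed.

Lemma open_preimage (S T : topologicalType) (f : S -> T) (A : set T) :
  continuous f -> open A -> open (f @^-1` A).
Proof. by move=> cf; apply: open_comp => x _; exact: cf. Qed.

Lemma cvg_finite_sum T (F : set_system T) {FF : Filter F} I (r : seq I)
    (f : I -> T -> R) (l : I -> R) : (forall i, f i @ F --> l i) ->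
  (fun x => \sum_(i <- r) f i x) @ F --> \sum_(i <- r) l i.
Proof.
move=> fl; elim: r => [|i r IH].
  by rewrite big_nil; under eq_fun do rewrite big_nil; exact: cvg_cst.
by rewrite big_cons; under eq_fun do rewrite big_cons; exact: cvgD.
Qed.

End Calculus.

(** * The classes C^k on open sets *)

Section Ck_theory.
Context {R : realType}.
Implicit Types V W : normedModType R.

Lemma CkW V W k (U : set V) (f : V -> W) : Ck k.+1 U f -> Ck k U f.
Proof.
elim: k f => [|k IH] f [fc fd]; first by [].
by split=> // v; have [dv /IH] := fd v.
Qed.

Lemma Ck_local V W k (U : set V) (f : V -> W) :
  (forall x, U x -> exists2 U', U' x & Ck k U' f) -> Ck k U f.
Proof.
elim: k f => [|k IH] f loc.
  by split=> // x /loc[U' Ux [fc _]]; exact: fc.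
split=> [x /loc[U' Ux [fc _]]|v]; first exact: fc.
split=> [x /loc[U' Ux [_ /(_ v)[dv _]]]|]; first exact: dv.
by apply: IH => x /loc[U' Ux [_ /(_ v)[_ Cv]]]; exists U'.
Qed.

Lemma open_near_eq V W (U : set V) (f g : V -> W) x : open U ->
  (forall z, U z -> f z = g z) -> U x -> \forall z \near x, f z = g z.
Proof. by move=> oU fg Ux; apply: filterS (open_nbhs_nbhs (conj oU Ux)). Qed.

Lemma Ck_eq V W k (U : set V) (f g : V -> W) : open U ->
  (forall x, U x -> f x = g x) -> Ck k U f -> Ck k U g.
Proof.
move=> oU; elim: k f g => [|k IH] f g fg [fc fd].
  split=> // x Ux; rewrite /prop_for /continuous_at -fg//.
  apply: cvg_trans (fc x Ux); apply: near_eq_cvg.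
  by apply: (open_near_eq oU) => // z Uz; rewrite fg.
have near_fg x : U x -> \forall z \near x, f z = g z.
  exact: open_near_eq.
split=> [x Ux|v].
  rewrite /prop_for /continuous_at -fg//.
  apply: cvg_trans (fc x Ux); apply: near_eq_cvg.
  exact: near_fg.
have [dv Cv] := fd v; split=> [x Ux|].
  by apply: near_eq_derivable (dv x Ux); exact: near_fg.
apply: IH Cv => x Ux; exact/near_eq_derive/near_fg.
Qed.

Lemma Ck_cst V W k (U : set V) (w : W) : Ck k U (cst w).
Proof.
elim: k w => [|k IH] w; first by split=> // x _; exact: cst_continuous.
split=> [x _|v]; first exact: cst_continuous.
split=> [x _|]; first exact: derivable_cst.
rewrite (_ : (fun x => _) = cst 0); first exact: IH.
by apply/funext => x; rewrite derive_cst.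
Qed.

Lemma is_derive_linear V W V' (L : V -> W) (f : V' -> V) x v d :
  continuous_linear L -> is_derive x v f d -> is_derive x v (L \o f) (L d).
Proof.
move=> cL [fd fdE].
have lim : (fun h : R => h^-1 *: (L (f (h *: v + x)) - L (f x))) @ 0^' --> L d.
  have -> : (fun h : R => h^-1 *: (L (f (h *: v + x)) - L (f x))) =
      (fun h : R => L (h^-1 *: (f (h *: v + x) - f x))).
    by apply/funext => h; rewrite (clinearZ _ _ cL) (clinearB _ _ cL).
  have fl : (fun h : R => h^-1 *: (f (h *: v + x) - f x)) @ 0^' --> d.
    by rewrite -fdE; exact: fd.
  exact: (cvg_comp _ _ fl (cL.2 d)).
split; first by apply/cvg_ex; eexists; exact: lim.
by rewrite /derive; apply: cvg_lim; [exact: norm_hausdorff|exact: lim].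
Qed.

Lemma Ck_linear_comp V W V' k (U : set V') (L : V -> W) (f : V' -> V) :
  open U -> continuous_linear L -> Ck k U f -> Ck k U (L \o f).
Proof.
move=> oU cL; elim: k f => [|k IH] f [fc fd].
  by split=> // x Ux; apply: continuous_comp; [exact: fc|exact: cL.2].
split=> [x Ux|v]; first by apply: continuous_comp; [exact: fc|exact: cL.2].
have [dv Cv] := fd v.
have D x : U x -> is_derive x v (L \o f) (L ('D_v f x)).
  by move=> Ux; apply: is_derive_linear => //; apply: derivableP; exact: dv.
split=> [x /D[]//|]; apply: Ck_eq (IH _ Cv) => // x Ux.
by have [_ ->] := D x Ux.
Qed.

Lemma Ck_id V k (U : set V) : Ck k U (@id V).
Proof.
case: k => [|k]; first by split=> // x _; exact: cvg_id.
split=> [x _|v]; first exact: cvg_id.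
split=> [x _|]; first exact: derivable_id.
rewrite (_ : (fun x => _) = cst v); first exact: Ck_cst.
by apply/funext => x; rewrite derive_id.
Qed.

Lemma Ck_linear V W k (U : set V) (L : V -> W) :
  open U -> continuous_linear L -> Ck k U L.
Proof.
move=> oU cL.
have := Ck_linear_comp oU cL (@Ck_id V k U); exact.
Qed.

Lemma Ck_add V W k (U : set V) (f g : V -> W) : open U ->
  Ck k U f -> Ck k U g -> Ck k U (f + g).
Proof.
move=> oU; elim: k f g => [|k IH] f g [fc fd] [gc gd].
  by split=> // x Ux; apply: cvgD; [exact: fc|exact: gc].
split=> [x Ux|v]; first by apply: cvgD; [exact: fc|exact: gc].
have [fdv fCv] := fd v; have [gdv gCv] := gd v.
split=> [x Ux|]; first by apply: derivableD; [exact: fdv|exact: gdv].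
apply: Ck_eq (IH _ _ fCv gCv) => // x Ux.
by rewrite deriveD; [|exact: fdv|exact: gdv].
Qed.

Lemma Ck_sum V W I (r : seq I) k (U : set V) (f : I -> V -> W) : open U ->
  (forall i, Ck k U (f i)) -> Ck k U (fun x => \sum_(i <- r) f i x).
Proof.
move=> oU Cf; elim: r => [|i r IH].
  by under eq_fun do rewrite big_nil; exact: Ck_cst.
by under eq_fun do rewrite big_cons; exact: Ck_add.
Qed.

Lemma Ck_mul V k (U : set V) (f g : V -> R) : open U ->
  Ck k U f -> Ck k U g -> Ck k U (f * g).
Proof.
move=> oU; elim: k f g => [|k IH] f g Cf Cg; have [fc fd] := Cf;
    have [gc gd] := Cg.
  by split=> // x Ux; apply: cvgM; [exact: fc|exact: gc].
split=> [x Ux|v]; first by apply: cvgM; [exact: fc|exact: gc].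
have [fdv fCv] := fd v; have [gdv gCv] := gd v.
split=> [x Ux|]; first by apply: derivableM; [exact: fdv|exact: gdv].
have C := Ck_add oU (IH _ _ (CkW Cf) gCv) (IH _ _ (CkW Cg) fCv).
apply: Ck_eq C => // x Ux.
by rewrite deriveM; [|exact: fdv|exact: gdv].
Qed.

Lemma Ck_C1_at V W k (U : set V) (f : V -> W) x : open U -> U x ->
  Ck k.+1 U f -> C1_at f x.
Proof.
move=> oU Ux [_ Cf] v; have [dv Cv] := Cf v; split.
  by apply: filterS (open_nbhs_nbhs (conj oU Ux)) => z; exact: dv.
by have [+ _] : Ck 0 U (fun z => 'D_v f z); [case: k {Cf} Cv => [|k] []|exact].
Qed.

(** The derivative of the composite in the direction [v] is the sum over the
    basis of products of coordinates of [D_v g] with [D_(e i) f \o g].  These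
    have one degree of smoothness less, hence the induction on [k]. *)
Lemma Ck_comp_real V V' k (A : set V) (U : set V') (f : V -> R) (g : V' -> V) :
  has_coords V -> open A -> open U -> (forall x, U x -> A (g x)) ->
  Ck k A f -> Ck k U g -> Ck k U (f \o g).
Proof.
move=> cV oA oU UA; have [m [e [a [ac ea]]]] := cV.
elim: k f g UA => [|k IH] f g UA Cf Cg; have [fc fd] := Cf;
    have [gc gd] := Cg.
  split=> // x Ux.
  by apply: continuous_comp; [exact: gc|apply: fc; exact: UA].
split=> [x Ux|v].
  by apply: continuous_comp; [exact: gc|apply: fc; exact: UA].
have [gdv gCv] := gd v.
have f1 x : U x -> C1_at f (g x) by move=> Ux; apply: Ck_C1_at Cf; auto.
have D x : U x -> is_derive x v (f \o g) ('D_('D_v g x) f (g x)).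
  move=> Ux; apply: is_derive_comp_C1 => //; first exact: f1.
  by apply: derivableP; exact: gdv.
split=> [x /D[]//|].
pose F i := (a i \o (fun x => 'D_v g x)) * ((fun z => 'D_(e i) f z) \o g).
have CF i : Ck k U (F i).
  apply: Ck_mul => //; first exact: Ck_linear_comp.
  by apply: IH => //; [have [] := fd (e i)|exact: CkW].
apply: Ck_eq (Ck_sum (index_enum 'I_m) oU CF) => // x Ux.
have [_ ->] := D x Ux.
by have [_ ->] := derive_coords ac ea ('D_v g x) (f1 x Ux).
Qed.

Lemma Ck_coords V W m (e : 'I_m -> W) (a : 'I_m -> W -> R) k
    (U : set V) (f : V -> W) : open U ->
  (forall w, w = \sum_i a i w *: e i) ->
  (forall i, Ck k U (a i \o f)) -> Ck k U f.
Proof.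
move=> oU ea Ca.
have C i : Ck k U (fun x => a i (f x) *: e i).
  apply: (Ck_linear_comp (L := fun c : R => c *: e i) oU _ (Ca i)).
  split; last exact: scalel_continuous.
  by move=> c x y; rewrite scalerDl scalerA.
apply: Ck_eq (Ck_sum (index_enum 'I_m) oU C) => //.
Qed.

Lemma Ck_comp V V' W k (A : set V) (U : set V') (f : V -> W) (g : V' -> V) :
  has_coords V -> has_coords W -> open A -> open U ->
  (forall x, U x -> A (g x)) -> Ck k A f -> Ck k U g -> Ck k U (f \o g).
Proof.
move=> cV [m [e [a [ac ea]]]] oA oU UA Cf Cg.
apply: Ck_coords ea _ => // i.
apply: (@Ck_comp_real _ _ k A U (a i \o f) g) => //.
exact: Ck_linear_comp.
Qed.

Lemma continuous_linear_fst V W : continuous_linear (@fst V W).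
Proof. by split=> // x; exact: cvg_fst. Qed.

Lemma continuous_linear_snd V W : continuous_linear (@snd V W).
Proof. by split=> // x; exact: cvg_snd. Qed.

Lemma continuous_linear_inl V W : continuous_linear (fun v : V => (v, 0 : W)).
Proof.
split=> [c x y|x].
  by rewrite [RHS]surjective_pairing/= scaler0 addr0.
by apply: cvg_pair; [exact: cvg_id|exact: cvg_cst].
Qed.

Lemma continuous_linear_inr V W : continuous_linear (fun w : W => (0 : V, w)).
Proof.
split=> [c x y|x].
  by rewrite [RHS]surjective_pairing/= scaler0 addr0.
by apply: cvg_pair; [exact: cvg_cst|exact: cvg_id].
Qed.

Lemma Ck_pair V V' W k (U : set V') (f : V' -> V) (g : V' -> W) : open U ->
  Ck k U f -> Ck k U g -> Ck k U (fun x => (f x, g x)).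
Proof.
move=> oU Cf Cg.
have C1 := Ck_linear_comp oU (continuous_linear_inl V W) Cf.
have C2 := Ck_linear_comp oU (continuous_linear_inr V W) Cg.
apply: Ck_eq (Ck_add oU C1 C2) => // x _.
by rewrite [LHS]surjective_pairing/= addr0 add0r.
Qed.

Lemma continuous_linear_comp V V' W (L : V -> W) (L' : V' -> V) :
  continuous_linear L -> continuous_linear L' -> continuous_linear (L \o L').
Proof.
move=> [lL cL] [lL' cL']; split=> [c x y|x]; first by rewrite /= lL' lL.
by apply: continuous_comp; [exact: cL'|exact: cL].
Qed.

Lemma has_coords_real : has_coords R.
Proof.
exists 1, (fun _ => 1), (fun _ => id); split=> [_|v].
  by split=> // x; exact: cvg_id.
by rewrite big_ord1 [v *: 1]mulr1.
Qed.

Lemma has_coords_rV n : has_coords 'rV[R]_n.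
Proof.
exists n, (fun i => delta_mx 0 i), (fun i (v : 'rV[R]_n) => v 0 i); split=> [i|v].
  by split=> [c x y|x]; [rewrite !mxE|exact: coord_continuous].
exact: row_sum_delta.
Qed.

Lemma has_coords_prod V W :
  has_coords V -> has_coords W -> has_coords (V * W)%type.
Proof.
move=> [m [e [a [ac ea]]]] [p [e' [a' [ac' ea']]]].
exists (m + p)%N, (fun k => match fintype.split k with
    inl i => (e i, 0) | inr j => (0, e' j) end),
  (fun k v => match fintype.split k with inl i => a i v.1 | inr j => a' j v.2 end).
split=> [k|[v w]].
  case: (fintype.split k) => [i|j].
    by apply: (continuous_linear_comp (ac i)); exact: continuous_linear_fst.
  by apply: (continuous_linear_comp (ac' j)); exact: continuous_linear_snd.
rewrite big_split_ord/=.
under eq_bigr => i _ do rewrite (unsplitK (inl _ i)).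
under [X in _ + X]eq_bigr => i _ do rewrite (unsplitK (inr _ i)).
rewrite [RHS]surjective_pairing/=; congr pair.
  rewrite (raddf_sum fst)/= (raddf_sum fst)/= [X in _ = _ + X]big1 ?addr0.
    exact: ea.
  by move=> i _; rewrite scaler0.
rewrite (raddf_sum snd)/= (raddf_sum snd)/= [X in _ = X + _]big1 ?add0r.
  exact: ea'.
by move=> i _; rewrite scaler0.
Qed.

Lemma Ck_continuous (V W : normedModType R) k (U : set V) (f : V -> W) x :
  Ck k U f -> U x -> {for x, continuous f}.
Proof. by case: k => [|k] [+ _]; apply. Qed.

Lemma Cinfty_is_derive (W : normedModType R) (J : set R) (G : R -> W) (t : R) :
  Cinfty J G -> J t -> is_derive t 1 G ('D_1 G t).
Proof.
by move=> /(_ 1%N)[_ /(_ 1)[+ _]] Jt => /(_ t Jt) ?; exact: derivableP.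
Qed.

End Ck_theory.

(** * A smooth reparametrization of the unit interval that is flat at the ends *)

Section Reparametrization.
Context {R : realType}.

Lemma is_derive_scale_dir (W : normedModType R) (f : R -> W) (x v : R) d :
  is_derive x 1 f d -> is_derive x v f (v *: d).
Proof.
move=> [/derivable1_diffP df <-]; split; first exact: diff_derivable.
by rewrite !deriveE// -[in LHS](mulr1 v) [LHS]linearZ.
Qed.

Lemma CkS_real k (f f' : R -> R) :
  (forall x : R, is_derive x 1 f (f' x)) -> Ck k setT f' -> Ck k.+1 setT f.
Proof.
move=> df Cf'; split=> [x _|v].
  by apply/differentiable_continuous/derivable1_diffP; have [] := df x.
have D x := is_derive_scale_dir v (df x).
split=> [x _|]; first by have [] := D x.
apply: (Ck_eq (f := cst v * f')) => //; first exact: openT.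
  by move=> x _; have [_ ->] := D x.
by apply: Ck_mul => //; [exact: openT|exact: Ck_cst].
Qed.

(** The functions [x^-m * exp (- 1 / x)] extended by 0.  The family, rather than
    its member [m = 0] alone, is stable under differentiation, and so can be
    shown smooth by induction on the order. *)
Definition flat (m : nat) (x : R) : R :=
  if 0 < x then x^-1 ^+ m * expR (- x^-1) else 0.

Lemma flat_le0 m x : x <= 0 -> flat m x = 0.
Proof. by rewrite /flat leNgt => /negbTE ->. Qed.

(** From [exp y = exp (y / N) ^ N >= (y / N) ^ N] with [y = 1 / x] and
    [N = m + 1].  It gives the differentiability at 0, where the difference
    quotient of [flat m] is [flat m.+1]. *)
Lemma flat_bound m x : `|flat m x| <= m.+1%:R ^+ m.+1 * `|x|.
Proof.
rewrite /flat; case: ifPn => [x0|_]; last first.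
  by rewrite normr0 mulr_ge0// exprn_ge0.
have y0 : 0 < x^-1 by rewrite invr_gt0.
rewrite ger0_norm; last by rewrite mulr_ge0 ?expR_ge0// exprn_ge0// ltW.
rewrite gtr0_norm// -ler_pdivrMr// mulrAC -exprSr expRN ler_pdivrMr ?expR_gt0//.
set y := x^-1 in y0 *.
have -> : expR y = expR (y / m.+1%:R) ^+ m.+1.
  by rewrite -expRM_natl mulrC divfK// pnatr_eq0.
rewrite -exprMn lerXn2r// ?nnegrE.
- exact: ltW.
- by rewrite mulr_ge0// expR_ge0.
rewrite mulrC -ler_pdivrMr ?ltr0n//.
by apply: le_trans (expR_ge1Dx _); rewrite lerDr.
Qed.

Lemma is_derive_flat m (x : R) :
  is_derive x 1 (flat m) (flat m.+2 x - m%:R * flat m.+1 x).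
Proof.
have [x0|x0|->] := ltgtP x 0.
- rewrite !flat_le0 ?ltW// mulr0 subrr.
  apply: (near_eq_is_derive _ (is_derive_cst (0 : R) x 1)).
  near=> z; rewrite flat_le0// ltW//; near: z.
  by apply: lt_nbhsl.
- have xn0 : x != 0 by rewrite gt_eqF.
  have di : is_derive x 1 (fun z : R => z^-1) (- x ^- 2).
    have := is_deriveV (f := id) xn0 (is_derive_id x 1).
    by rewrite [_ *: _]mulr1.
  have dp : is_derive x 1 (fun z : R => z^-1 ^+ m)
      (m%:R * x^-1 ^+ m.-1 * (- x ^- 2)).
    by have := is_deriveX m di; rewrite exprfctE.
  have de : is_derive x 1 (fun z : R => expR (- z^-1))
      (expR (- x^-1) * (x ^- 2)).
    have dn := is_deriveN di; rewrite opprK in dn.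
    exact: is_derive1_comp (is_derive_expR _) dn.
  have D := near_eq_is_derive _ (is_deriveM dp de).
  apply: is_derive_eq (D (flat m) _) _.
    near=> z; rewrite /flat ifT//; near: z.
    by apply: lt_nbhsr.
  rewrite /flat x0 /GRing.scale/= -!exprVn.
  case: m {dp D} => [|m] /=; rewrite ?exprS ?expr0; ring.
- rewrite !flat_le0// mulr0 subrr.
  have lim : (fun h : R => h^-1 *: (flat m (h *: 1 + 0) - flat m 0)) @ 0^' -->
      (0 : R).
    apply/cvgr0Pnorm_le => e e0.
    pose C : R := m.+2%:R ^+ m.+2.
    have C0 : 0 < C by rewrite exprn_gt0.
    near=> h.
    have hn0 : h != 0 by near: h; exact: nbhs_dnbhs_neq.
    rewrite (flat_le0 m (lexx 0)) subr0 addr0 [h *: 1]mulr1.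
    apply: (@le_trans _ _ `|flat m.+1 h|).
      rewrite /flat; case: ifP => h0; last by rewrite scaler0.
      by rewrite [_ *: _]mulrA exprS.
    apply: le_trans (flat_bound _ _) _.
    rewrite -ler_pdivlMl// mulrC ltW//; near: h.
    apply: dnbhs0_lt; exact: divr_gt0.
  split; first by apply/cvg_ex; eexists; exact: lim.
  by rewrite /derive; apply: cvg_lim; [exact: norm_hausdorff|exact: lim].
Unshelve. all: by end_near. Qed.

Lemma Cinfty_flat m : Cinfty setT (flat m).
Proof.
move=> k; elim: k m => [|k IH] m.
  split=> // x _; apply/differentiable_continuous/derivable1_diffP.
  by have [] := is_derive_flat m x.
apply: CkS_real (is_derive_flat m) _.
apply: (Ck_eq (f := flat m.+2 + cst (- m%:R) * flat m.+1)) => //.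
- exact: openT.
- by move=> x _; rewrite /= mulNr.
apply: Ck_add => //; first exact: openT.
by apply: Ck_mul => //; [exact: openT|exact: Ck_cst].
Qed.

Lemma flat0_gt0 x : 0 < x -> 0 < flat 0 x.
Proof. by rewrite /flat => ->; rewrite mul1r expR_gt0. Qed.

Lemma flat0_ge0 x : 0 <= flat 0 x.
Proof. by have [/flat0_gt0/ltW|/flat_le0 ->] := ltP 0 x. Qed.

Lemma flat0_homo x y : x <= y -> flat 0 x <= flat 0 y.
Proof.
move=> xy; have [x0|x0] := leP x 0; first by rewrite flat_le0// flat0_ge0.
have y0 := lt_le_trans x0 xy.
by rewrite /flat x0 y0 !mul1r ler_expR lerN2 lef_pV2.
Qed.

(** The inner difference is nonpositive up to 1 and constant from 2 on; a second
    application of [flat 0] turns it into a function that is locally constant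
    on both sides. *)
Definition smooth_step (x : R) : R :=
  (flat 0 (flat 0 1))^-1 * flat 0 (flat 0 1 - flat 0 (2 - x)).

Lemma smooth_step_itv x : 0 <= smooth_step x <= 1.
Proof.
have e1 : 0 < flat 0 (flat 0 1) by rewrite !flat0_gt0.
rewrite /smooth_step mulr_ge0 ?invr_ge0 ?flat0_ge0//=.
by rewrite mulrC ler_pdivrMr// mul1r flat0_homo// lerBlDr lerDl flat0_ge0.
Qed.

Lemma smooth_step0 x : x <= 1 -> smooth_step x = 0.
Proof.
move=> x1; rewrite /smooth_step [X in _ * X]flat_le0 ?mulr0//.
by rewrite subr_le0 flat0_homo//; lra.
Qed.

Lemma smooth_step1 x : 2 <= x -> smooth_step x = 1.
Proof.
move=> x2; rewrite /smooth_step [X in _ - X]flat_le0 ?subr0 ?mulVf//; last lra.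
by rewrite gt_eqF// !flat0_gt0.
Qed.

Lemma Cinfty_affine (a b : R) : Cinfty setT (fun x : R => a * x + b).
Proof.
move=> k; apply: (@Ck_add _ _ _ _ _ (fun x => a * x) (cst b)) => //.
- exact: openT.
- apply: (@Ck_mul _ _ _ _ (cst a) id); [exact: openT|exact: Ck_cst|exact: Ck_id].
- exact: Ck_cst.
Qed.

Lemma Cinfty_comp_real (f g : R -> R) :
  Cinfty setT f -> Cinfty setT g -> Cinfty setT (f \o g).
Proof.
move=> Cf Cg k; apply: (@Ck_comp_real _ _ _ _ setT) => //;
  by [exact: has_coords_real|exact: openT].
Qed.

Lemma Cinfty_smooth_step : Cinfty setT smooth_step.
Proof.
have sub c : Cinfty setT (fun x : R => c - x).
  move=> k; apply: Ck_eq (Cinfty_affine (-1) c k); first exact: openT.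
  by move=> x _; rewrite mulN1r addrC.
have C := Cinfty_comp_real (Cinfty_comp_real (@Cinfty_flat 0) (sub (flat 0 1)))
  (Cinfty_comp_real (@Cinfty_flat 0) (sub 2)).
move=> k; apply: (@Ck_mul _ _ _ _ (cst _)); [exact: openT|exact: Ck_cst|].
exact: C.
Qed.

Lemma Cinfty_derive1 (f : R -> R) :
  Cinfty setT f -> continuous (fun x : R => 'D_1 f x).
Proof. by move=> /(_ 1%N)[_ /(_ 1)[_ [+ _]]] x; apply. Qed.

(** Equal to 0 up to 1 and to the identity from 2 on. *)
Definition ramp (x : R) : R := x * smooth_step x.

Lemma Cinfty_ramp : Cinfty setT ramp.
Proof.
move=> k; apply: (@Ck_mul _ _ _ _ id); [exact: openT|exact: Ck_id|].
exact: Cinfty_smooth_step.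
Qed.

Lemma derive_ramp0 (x : R) : x < 1 -> 'D_1 ramp x = 0.
Proof.
move=> x1; rewrite (@near_eq_derive _ _ _ _ (cst 0)); first exact: derive_cst.
near=> z; rewrite /ramp smooth_step0 ?mulr0// ltW//; near: z.
exact: lt_nbhsl.
Unshelve. all: by end_near. Qed.

Lemma derive_ramp1 (x : R) : 2 < x -> 'D_1 ramp x = 1.
Proof.
move=> x2; rewrite (@near_eq_derive _ _ _ _ id); first exact: derive_id.
near=> z; rewrite /ramp smooth_step1 ?mulr1// ltW//; near: z.
exact: lt_nbhsr.
Unshelve. all: by end_near. Qed.

Lemma derive_ramp_bounded :
  exists2 K : R, 0 <= K & forall x : R, 0 <= x -> `|'D_1 ramp x| <= K.
Proof.
have cD : {within `[0, 2], continuous (fun x : R => `|'D_1 ramp x|)}.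
  apply: continuous_subspaceT => x; apply: cvg_norm.
  exact: Cinfty_derive1 Cinfty_ramp x.
have [c _ cP] := EVT_max (ler0n R 2) cD.
exists (`|'D_1 ramp c| + 1); first by rewrite addr_ge0.
move=> x x0; have [x2|x2] := leP x 2.
  by apply: (le_trans (cP x _)); rewrite ?in_itv/= ?x0// lerDl.
by rewrite derive_ramp1// normr1 lerDr.
Qed.

(** Rescaling [ramp] to [h t := delta * ramp (t / delta)] leaves the range of its
    derivative unchanged, which makes [K] independent of [delta].  The map
    [zeta] uses [h] at 0 and its mirror image at 1; at least one of the two is
    the identity at every time. *)
Lemma smooth_reparametrization : exists2 K : R, 0 <= K &
  forall delta : R, 0 < delta -> delta < 1 / 4 ->
  exists zeta : R -> R, [/\ Cinfty setT zeta, zeta 0 = 0 /\ zeta 1 = 1,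
    forall t : R, 0 <= t <= 1 ->
      [/\ 0 <= zeta t <= 1, `|zeta t - t| <= 2 * delta & `|'D_1 zeta t| <= K],
    forall t : R, 2 * delta < t < 1 - 2 * delta -> 'D_1 zeta t = 1 &
    forall t : R, t < delta \/ 1 - delta < t -> 'D_1 zeta t = 0].
Proof.
have [K K0 rampK] := derive_ramp_bounded.
exists (K + 1 + K); first by rewrite !addr_ge0.
move=> d d0 d4.
have dn0 : d != 0 by rewrite gt_eqF.
pose h t := d * ramp (t / d).
have hE t : h t = t * smooth_step (t / d).
  by rewrite /h /ramp; field.
pose zeta t := h t + (1 - t) - h (1 - t).
have hid t : 2 * d <= t -> h t = t.
  by move=> t2; rewrite hE smooth_step1 ?mulr1// ler_pdivlMr.
have h0 t : t <= d -> h t = 0.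
  by move=> t2; rewrite hE smooth_step0 ?mulr0// ler_pdivrMr// mul1r.
have hitv t : 0 <= t -> 0 <= h t <= t.
  move=> t0; have /andP[s0 s1] := smooth_step_itv (t / d).
  by rewrite hE mulr_ge0//= ler_piMr.
have hd t : 0 <= t -> `|h t - t| <= 2 * d.
  move=> t0; have [t2|/hid ->] := ltP t (2 * d); last first.
    by rewrite subrr normr0 mulr_ge0// ltW.
  have /andP[] := hitv t t0; rewrite ler_norml => ? ?; lra.
have Ch : Cinfty setT h.
  move=> k; apply: (@Ck_mul _ _ _ _ (cst d)); [exact: openT|exact: Ck_cst|].
  apply: (Cinfty_comp_real (g := fun t => t / d) Cinfty_ramp) => {}k.
  apply: Ck_eq (Cinfty_affine d^-1 0 k); first exact: openT.
  by move=> x _; rewrite addr0 mulrC.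
have Cz : Cinfty setT zeta.
  move=> k; apply: (Ck_eq (f := (h + (fun t => -1 * t + 1)) +
      cst (-1) * (h \o (fun t => -1 * t + 1)))); first exact: openT.
    move=> x _; rewrite /zeta; have -> : 1 - x = -1 * x + 1 by ring.
    by rewrite -[X in _ = _ - X]mul1r -mulNr.
  apply: Ck_add; first exact: openT.
    by apply: Ck_add; [exact: openT|exact: Ch|exact: Cinfty_affine].
  apply: Ck_mul; [exact: openT|exact: Ck_cst|].
  apply: Cinfty_comp_real => //; exact: Cinfty_affine.
have dh (t : R) : is_derive t 1 h ('D_1 ramp (t / d)).
  have dl : is_derive t 1 (fun t : R => t / d) d^-1.
    have := is_deriveM (is_derive_id t 1) (is_derive_cst (d^-1 : R) t 1).
    move/is_derive_eq; apply.
    by rewrite scaler0 add0r [_ *: _]mulr1.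
  have := is_derive1_comp (g := fun t => t / d)
    (Cinfty_is_derive Cinfty_ramp Logic.I) dl.
  move/(is_deriveZ d)/is_derive_eq; apply.
  by rewrite [_ *: _]mulrCA divff// mulr1.
have dz (t : R) : 'D_1 zeta t = 'D_1 ramp (t / d) - 1 + 'D_1 ramp ((1 - t) / d).
  have d1 : is_derive t 1 (fun t : R => 1 - t) (-1).
    have := is_deriveB (is_derive_cst (1 : R) t 1) (is_derive_id t 1).
    move/is_derive_eq; apply.
    by rewrite sub0r.
  have d2 := is_derive1_comp (g := fun t => 1 - t) (dh (1 - t)) d1.
  have [_ ->] := is_deriveB (is_deriveD (dh t) d1) d2.
  by rewrite mulrN1 opprK.
have zE t : zeta t = h t + (1 - t) - h (1 - t) by [].
clearbody zeta; clearbody h.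
exists zeta; split=> //.
- have e0 : h 0 = 0 by apply: h0; lra.
  have e1 : h 1 = 1 by apply: hid; lra.
  by rewrite !zE subr0 subrr e0 e1; split; lra.
- move=> t /andP[t0 t1]; split.
  + have := hitv t t0; have := hitv (1 - t); rewrite subr_ge0 => /(_ t1).
    move=> /andP[? ?] /andP[? ?].
    have [t2|t2] := leP t (1 / 2).
      by rewrite !zE (hid (1 - t)); [apply/andP; split; lra|lra].
    by rewrite !zE (hid t); [apply/andP; split; lra|lra].
  + have [t2|t2] := leP t (1 / 2).
      rewrite !zE (hid (1 - t)); last lra.
      by rewrite addrK hd.
    rewrite !zE (hid t); last lra.
    have := hd (1 - t); rewrite subr_ge0 => /(_ t1).
    rewrite !ler_norml => /andP[? ?]; apply/andP; split; lra.
  + rewrite dz (le_trans (ler_normD _ _))// lerD//; last first.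
      by rewrite rampK// divr_ge0 ?subr_ge0// ltW.
    rewrite (le_trans (ler_normB _ _))// lerD ?normr1//.
    by rewrite rampK// divr_ge0// ltW.
- move=> t /andP[t2 t2']; rewrite dz !derive_ramp1 ?ltr_pdivlMr//; lra.
- move=> t [td|td]; rewrite dz.
    rewrite derive_ramp0 ?ltr_pdivrMr ?mul1r//.
    rewrite derive_ramp1 ?ltr_pdivlMr//; lra.
  rewrite derive_ramp1 ?ltr_pdivlMr//; last lra.
  by rewrite derive_ramp0 ?ltr_pdivrMr ?mul1r//; lra.
Qed.

End Reparametrization.

(** * Tangent vectors and velocities in coordinates *)

Section Tangent.
Context {R : realType} {n : nat} {M : ptopologicalType}.
Variable X : smooth_manifold R n M.
Implicit Types (c : chart R n M) (f g : M -> R).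

Lemma smooth_fun_lin (a : R) f g : smooth_fun X f -> smooth_fun X g ->
  smooth_fun X (fun y => a * f y + g y).
Proof.
move=> sf sg c ac k; have oc := image_open ac.
apply: (@Ck_add _ _ _ _ _ (fun u => a * f (param c u)) (g \o param c)) => //.
  by apply: (@Ck_mul _ _ _ _ (cst a) (f \o param c)) => //;
    [exact: Ck_cst|exact: sf].
exact: sg.
Qed.

Lemma smooth_fun_mul f g : smooth_fun X f -> smooth_fun X g ->
  smooth_fun X (fun y => f y * g y).
Proof.
move=> sf sg c ac k; have oc := image_open ac.
by apply: (@Ck_mul _ _ _ _ (f \o param c) (g \o param c)) => //;
  [exact: sf|exact: sg].
Qed.

Lemma image_coords c x : dom c x -> image_of c (coords c x).
Proof. by move=> cx; exists x. Qed.

Lemma paramK c x : atlas X c -> dom c x -> param c (coords c x) = x.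
Proof. by move=> ac cx; rewrite (coordsK ac)// mem_set. Qed.

Lemma coords_paramK c u : atlas X c -> image_of c u -> coords c (param c u) = u.
Proof. by move=> ac [x cx <-]; rewrite paramK. Qed.

Lemma dom_param c u : atlas X c -> image_of c u -> dom c (param c u).
Proof. by move=> ac [x cx <-]; rewrite paramK. Qed.

Lemma smooth_fun_C1 c f u : atlas X c -> image_of c u -> smooth_fun X f ->
  C1_at (f \o param c) u.
Proof. by move=> ac cu sf; apply: Ck_C1_at (image_open ac) cu (sf c ac 1%N). Qed.

Lemma smooth_fun_derive c f u v : atlas X c -> image_of c u -> smooth_fun X f ->
  is_derive u v (f \o param c) ('D_v (f \o param c) u).
Proof.
move=> ac cu sf; apply: derivableP.
by have [/nbhs_singleton] := smooth_fun_C1 ac cu sf v.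
Qed.

Lemma on_smoothT D f : smooth_fun X f -> on_smooth X D f = D f.
Proof. by move=> sf; rewrite /on_smooth asboolT. Qed.

Lemma on_smoothF D f : ~ smooth_fun X f -> on_smooth X D f = 0.
Proof. by move=> sf; rewrite /on_smooth asboolF. Qed.

Lemma on_smooth_idem D : on_smooth X (on_smooth X D) = on_smooth X D.
Proof. by apply/funext => f; rewrite /on_smooth; case: asboolP. Qed.

Lemma tangent_coord_vector c i x : atlas X c -> dom c x ->
  tangent X x (coord_vector X c i x).
Proof.
move=> ac cx; have cu := image_coords cx.
split; first exact: on_smooth_idem.
  move=> a f g sf sg; rewrite /coord_vector !on_smoothT//; last first.
    exact: smooth_fun_lin.
  have df := smooth_fun_derive (delta_mx 0 i) ac cu sf.
  have dg := smooth_fun_derive (delta_mx 0 i) ac cu sg.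
  by have [_] := is_deriveD (is_deriveZ a df) dg.
move=> f g sf sg; rewrite /coord_vector !on_smoothT//; last first.
  exact: smooth_fun_mul.
have df := smooth_fun_derive (delta_mx 0 i) ac cu sf.
have dg := smooth_fun_derive (delta_mx 0 i) ac cu sg.
by have [_] := is_deriveM df dg; rewrite /= paramK.
Qed.

Lemma tangent_nonsmooth x Y f : tangent X x Y -> ~ smooth_fun X f -> Y f = 0.
Proof. by move=> [<- _ _] sf; exact: on_smoothF. Qed.

Lemma tangent_lin x (a : R) Y Z : tangent X x Y -> tangent X x Z ->
  tangent X x (fun f => a * Y f + Z f).
Proof.
move=> TY TZ; have [_ linY derY] := TY; have [_ linZ derZ] := TZ; split.
- apply/funext => f; rewrite /on_smooth; case: asboolP => // sf.
  by rewrite (tangent_nonsmooth TY)// (tangent_nonsmooth TZ)// mulr0 addr0.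
- by move=> b f g sf sg; rewrite linY// linZ//; ring.
- by move=> f g sf sg; rewrite derY// derZ//; ring.
Qed.

Lemma tangent0 x : tangent X x (fun=> 0).
Proof.
split=> [|a f g _ _|f g _ _]; last 2 first.
- by rewrite mulr0 addr0.
- by rewrite !mulr0 addr0.
by apply/funext => f; rewrite /on_smooth; case: asboolP.
Qed.

(** A linear combination [a * f + g] with [g = f] spares the zero function. *)
Lemma tangent_funZ x Z (a : R) f : tangent X x Z -> smooth_fun X f ->
  Z (fun y => a * f y) = a * Z f.
Proof.
move=> [_ linZ _] sf; have := linZ (a - 1) f f sf sf.
have -> : (fun y => (a - 1) * f y + f y) = (fun y => a * f y).
  by apply/funext => y; ring.
by move=> ->; ring.
Qed.

Lemma tangent_sum x I (r : seq I) (w : I -> R) (E : I -> operator) :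
  (forall i, tangent X x (E i)) ->
  tangent X x (fun f => \sum_(i <- r) w i * E i f).
Proof.
move=> TE; elim: r => [|i r IH].
  by under eq_fun do rewrite big_nil; exact: tangent0.
by under eq_fun do rewrite big_cons; exact: tangent_lin.
Qed.

Lemma linear_on0 x alpha : linear_on X x alpha -> alpha (fun=> 0) = 0.
Proof.
move=> /(_ 1 _ _ (tangent0 x) (tangent0 x)); rewrite !mul1r addr0.
by rewrite -[LHS]addr0 => /addrI/esym.
Qed.

Lemma linear_onZ x alpha (a : R) Y : linear_on X x alpha -> tangent X x Y ->
  alpha (fun f => a * Y f) = a * alpha Y.
Proof.
move=> la TY; have := la a _ _ TY (tangent0 x).
by rewrite (linear_on0 la) addr0; under eq_fun do rewrite addr0.
Qed.

Lemma linear_on_sum x alpha I (r : seq I) (w : I -> R) (E : I -> operator) :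
  linear_on X x alpha -> (forall i, tangent X x (E i)) ->
  alpha (fun f => \sum_(i <- r) w i * E i f) = \sum_(i <- r) w i * alpha (E i).
Proof.
move=> la TE; elim: r => [|i r IH].
  by under eq_fun do rewrite big_nil; rewrite big_nil (linear_on0 la).
under eq_fun do rewrite big_cons.
by rewrite la ?IH ?big_cons//; exact: tangent_sum.
Qed.

Definition coord_comb c (w : 'rV[R]_n) (x : M) : operator :=
  fun f => \sum_i w 0 i * coord_vector X c i x f.

Lemma tangent_coord_comb c w x : atlas X c -> dom c x ->
  tangent X x (coord_comb c w x).
Proof.
move=> ac cx; apply: (tangent_sum _ (w 0) (E := fun i => coord_vector X c i x)).
by move=> i; exact: tangent_coord_vector.
Qed.

Lemma linear_on_coord_comb c w x alpha : linear_on X x alpha ->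
  atlas X c -> dom c x ->
  alpha (coord_comb c w x) = \sum_i w 0 i * alpha (coord_vector X c i x).
Proof.
move=> la ac cx.
apply: (linear_on_sum _ (w 0) (E := fun i => coord_vector X c i x) la) => i.
exact: tangent_coord_vector.
Qed.

Lemma coord_combZ c (a : R) w x :
  coord_comb c (a *: w) x = (fun f => a * coord_comb c w x f).
Proof.
apply/funext => f; rewrite /coord_comb mulr_sumr.
by apply: eq_bigr => i _; rewrite mxE mulrA.
Qed.

Lemma coord_combE c (w : 'rV[R]_n) x f : atlas X c -> dom c x ->
  smooth_fun X f -> coord_comb c w x f = 'D_w (f \o param c) (coords c x).
Proof.
move=> ac cx sf.
have lin (i : 'I_n) : continuous_linear (fun v : 'rV[R]_n => v 0 i).
  by split=> [b u v|u]; [rewrite !mxE|exact: coord_continuous].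
have [_ ->] := derive_coords lin (@row_sum_delta _ _) w
  (smooth_fun_C1 ac (image_coords cx) sf).
by apply: eq_bigr => i _; rewrite /coord_vector on_smoothT.
Qed.

(** The two-sided derivative of an extension computes the relative one
    because no point of the interval is isolated in it. *)
Lemma derive_in_eq (h k : R -> R) (t d : R) : 0 <= t <= 1 ->
  (\forall s \near t, 0 <= s <= 1 -> h s = k s) ->
  is_derive t 1 k d -> derive_in `[0, 1] h t = d.
Proof.
move=> t01 hk [dk dkE].
have pf : ProperFilter (within `[0, 1] t^').
  split; last exact: within_filter.
  move/nbhs_ballP => [r /= r0 rP].
  pose e := Num.min (r / 2) (1 / 2) : R.
  have e0 : 0 < e by rewrite lt_min !divr_gt0.
  have er : e < r by rewrite gt_min; apply/orP; left; lra.
  have e2 : e <= 1 / 2 by rewrite ge_min lexx orbT.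
  clearbody e; move: t01 => /andP[t0 t1].
  have [t2|t2] := leP t (1 / 2).
    apply: (rP (t + e)); rewrite /ball/= ?in_itv/=.
    - by rewrite opprD addrA subrr sub0r normrN gtr0_norm.
    - by apply/eqP => E; lra.
    - by apply/andP; split; lra.
  apply: (rP (t - e)); rewrite /ball/= ?in_itv/=.
  - by rewrite opprB addrCA subrr addr0 gtr0_norm.
  - by apply/eqP => E; lra.
  - by apply/andP; split; lra.
have lim : (fun s => (k s - k t) / (s - t)) @ t^' --> d.
  apply/cvgrPdist_le => e e0.
  have : (fun h : R => h^-1 *: (k (h *: 1 + t) - k t)) @ 0^' --> d.
    by rewrite -dkE; exact: dk.
  move=> /cvgrPdist_le/(_ e e0)/nbhs_ballP[r /= r0 rP].
  apply/nbhs_ballP; exists r => //= s; rewrite /ball/= => st sNt.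
  have := rP (s - t); rewrite /ball/= sub0r normrN distrC.
  move=> /(_ st); rewrite subr_eq0 => /(_ sNt).
  by rewrite [(s - t) *: 1]mulr1 subrK [_ *: _]mulrC.
have lim2 : (fun s => (k s - k t) / (s - t)) @ within `[0, 1] t^' --> d.
  exact: cvg_within_filter lim.
have ht : h t = k t by exact: (nbhs_singleton hk).
apply: cvg_lim; first exact: norm_hausdorff.
apply: (cvg_trans _ lim2); apply: near_eq_cvg.
have near_hk : \forall s \near t^', 0 <= s <= 1 -> h s = k s.
  exact: cvg_within hk.
by apply: filterS near_hk => s hks; rewrite /= in_itv/= => /hks ->; rewrite ht.
Qed.

(** The coordinates of a velocity vector are the derivatives of the coordinates
    of the curve.  The curve may be known in the chart only for times in the
    interval, so that [G] can be the extension of its coordinates which a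
    smooth path provides at the end points. *)
Lemma velocity_coords c (gam : R -> M) (G : R -> 'rV[R]_n) (t : R) w :
  atlas X c -> 0 <= t <= 1 -> image_of c (G t) ->
  (\forall s \near t, 0 <= s <= 1 -> gam s = param c (G s)) ->
  is_derive t 1 G w ->
  velocity X `[0, 1] gam t = coord_comb c w (gam t).
Proof.
move=> ac t01 cG gamG dG.
have gt : gam t = param c (G t) by exact: (nbhs_singleton gamG).
have cg : dom c (gam t) by rewrite gt; exact: dom_param.
apply/funext => f; have [sf|sf] := pselect (smooth_fun X f); last first.
  rewrite /velocity on_smoothF//.
  by rewrite (tangent_nonsmooth (tangent_coord_comb w ac cg) sf).
rewrite coord_combE// gt coords_paramK// /velocity on_smoothT//.
apply: (derive_in_eq (k := (f \o param c) \o G)) => //.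
  by apply: filterS gamG => s gs s01; rewrite /= gs.
apply: is_derive_comp_C1 dG; first exact: has_coords_rV.
exact: smooth_fun_C1.
Qed.

End Tangent.

(** * Smooth paths of maps and of functions, and their reparametrizations *)

Section Paths.
Context {R : realType}.

Context {n : nat} {M : ptopologicalType}.
Variable X : smooth_manifold R n M.
Implicit Types (c : chart R n M) (phi : R -> M -> M).

(** Local form of a smooth path of maps: some chart of the target contains the
    image of a whole neighbourhood, in time and space. *)
Lemma smooth_map_path_coords phi (t0 : R) x0 c : smooth_map_path X phi ->
  0 <= t0 <= 1 -> atlas X c -> dom c x0 ->
  exists c' (U : set (R * 'rV[R]_n)) (G : R * 'rV[R]_n -> 'rV[R]_n),
    [/\ atlas X c', open U, U (t0, coords c x0), Cinfty U G &
      forall (t : R) u, U (t, u) -> 0 <= t <= 1 -> image_of c u ->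
        image_of c' (G (t, u)) /\ phi t (param c u) = param c' (G (t, u))].
Proof.
move=> sphi t01 ac cx.
have [c' ac' cx'] := atlas_cover X (phi t0 x0).
have [||U [G [oU Up CG GE]]] := sphi c ac (t0, coords c x0) c' _ ac'.
- by split; rewrite /= ?in_itv//; exact: image_coords.
- by rewrite /= (paramK ac).
exists c', U, G; split=> // t u Utu t1 cu.
have [dE cE] : dom c' (phi t (param c u)) /\
    coords c' (phi t (param c u)) = G (t, u).
  by apply: (GE (t, u)) => //; split; rewrite /= ?in_itv.
by rewrite -cE (paramK ac')//; split=> //; exact: image_coords.
Qed.

Lemma path_coords phi (t0 : R) x : smooth_map_path X phi -> 0 <= t0 <= 1 ->
  exists c (J : set R) (G : R -> 'rV[R]_n),
    [/\ atlas X c, open J, J t0, Cinfty J G &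
      forall t : R, J t -> 0 <= t <= 1 ->
        image_of c (G t) /\ phi t x = param c (G t)].
Proof.
move=> sphi t01; have [c ac cx] := atlas_cover X x.
have [c' [U [G [ac' oU Ut CG GE]]]] := smooth_map_path_coords sphi t01 ac cx.
pose l (t : R) := (t, coords c x).
have Cl k J : open J -> Ck k J l.
  by move=> oJ; apply: Ck_pair => //; [exact: Ck_id|exact: Ck_cst].
have cl : continuous l by move=> t; apply: Ck_continuous (Cl 0%N _ openT) _.
have oJ : open (l @^-1` U) by exact: open_preimage.
exists c', (l @^-1` U), (G \o l); split=> //.
- move=> k; apply: (Ck_comp (A := U)) => //.
  + by apply: has_coords_prod; [exact: has_coords_real|exact: has_coords_rV].
  + exact: has_coords_rV.
  + exact: Cl.
- move=> t Jt t1; have [] := GE t (coords c x) Jt t1 (image_coords cx).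
  by rewrite (paramK ac).
Qed.

Lemma near_open01 (J : set R) (P : R -> Prop) (t : R) : open J -> J t ->
  (forall s, J s -> 0 <= s <= 1 -> P s) ->
  \forall s \near t, 0 <= s <= 1 -> P s.
Proof.
by move=> oJ Jt JP; apply: filterS (open_nbhs_nbhs (conj oJ Jt)) => s /JP.
Qed.

Lemma velocity_path_coords phi x c (J : set R) (G : R -> 'rV[R]_n) (t : R) :
  atlas X c -> open J -> Cinfty J G ->
  (forall t : R, J t -> 0 <= t <= 1 ->
     image_of c (G t) /\ phi t x = param c (G t)) ->
  J t -> 0 <= t <= 1 ->
  velocity X `[0, 1] (phi^~ x) t = coord_comb X c ('D_1 G t) (phi t x).
Proof.
move=> ac oJ CG GE Jt t01; have [cG _] := GE t Jt t01.
apply: velocity_coords (Cinfty_is_derive CG Jt) => //.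
by apply: (near_open01 oJ) => // s Js s01; case: (GE s Js s01).
Qed.

Lemma tangent_velocity phi x (t : R) : smooth_map_path X phi -> 0 <= t <= 1 ->
  tangent X (phi t x) (velocity X `[0, 1] (phi^~ x) t).
Proof.
move=> sphi t01; have [c [J [G [ac oJ Jt CG GE]]]] := path_coords x sphi t01.
rewrite (velocity_path_coords ac oJ CG GE)//.
have [cG ->] := GE t Jt t01.
by apply: tangent_coord_comb => //; exact: (dom_param ac).
Qed.

Section Reparam.
Variable zeta : R -> R.
Hypotheses (zeta_smooth : Cinfty setT zeta)
  (zeta01 : forall t : R, 0 <= t <= 1 -> 0 <= zeta t <= 1).

(** The chain rule for a change of time: in a chart both sides are multiples of
    the same coordinate derivative. *)
Lemma velocity_reparam phi x (t : R) : smooth_map_path X phi -> 0 <= t <= 1 ->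
  velocity X `[0, 1] (fun s => phi (zeta s) x) t =
  (fun f => 'D_1 zeta t * velocity X `[0, 1] (phi^~ x) (zeta t) f).
Proof.
move=> sphi t01; have z01 := zeta01 t01.
have [c [J [G [ac oJ Jt CG GE]]]] := path_coords x sphi z01.
rewrite (velocity_path_coords ac oJ CG GE)// -coord_combZ.
have [cG _] := GE _ Jt z01.
have zc : {for t, continuous zeta}.
  exact: Ck_continuous (zeta_smooth 0%N) Logic.I.
apply: (velocity_coords (G := G \o zeta)) => //; last first.
  exact: is_derive1_comp_vect (Cinfty_is_derive CG Jt)
    (Cinfty_is_derive zeta_smooth Logic.I).
have nJ : \forall s \near t, J (zeta s) by apply: zc; exact: open_nbhs_nbhs.
by apply: filterS nJ => s Js /zeta01 zs; case: (GE _ Js zs).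
Qed.

Lemma path_velocity_reparam phi (t : R) y : smooth_map_path X phi -> 0 <= t <= 1 ->
  path_velocity X (fun s => phi (zeta s)) t y =
  (fun f => 'D_1 zeta t * path_velocity X phi (zeta t) y f).
Proof. by move=> sphi t01; exact: velocity_reparam. Qed.

Let Z (q : R * 'rV[R]_n) : R * 'rV[R]_n := (zeta q.1, q.2).

Let CZ k (U : set (R * 'rV[R]_n)) : open U -> Ck k U (zeta \o fst).
Proof.
move=> oU; apply: (Ck_comp_real (A := setT)) => //.
- exact: has_coords_real.
- exact: openT.
- by apply: Ck_linear => //; exact: continuous_linear_fst.
Qed.

Let Z_smooth k U : open U -> Ck k U Z.
Proof.
move=> oU; apply: (@Ck_pair _ _ _ _ _ _ (zeta \o fst) snd) => //.
  exact: CZ.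
by apply: Ck_linear => //; exact: continuous_linear_snd.
Qed.

Let Z_cont : continuous Z.
Proof. by move=> q; apply: Ck_continuous (Z_smooth 0 openT) Logic.I. Qed.

Let Z_image c q : (`[0, 1] `*` image_of c) q -> (`[0, 1] `*` image_of c) (Z q).
Proof. by move=> [/= + cq]; rewrite in_itv/= => /zeta01 z; rewrite in_itv. Qed.

Let rV_coords : has_coords (R * 'rV[R]_n)%type.
Proof.
by apply: has_coords_prod; [exact: has_coords_real|exact: has_coords_rV].
Qed.

Lemma smooth_map_path_reparam phi : smooth_map_path X phi ->
  smooth_map_path X (fun t => phi (zeta t)).
Proof.
move=> sphi c ac p c' Sp ac' cp.
have [|U [G [oU Up CG GE]]] := sphi c ac (Z p) c' _ ac' cp.
  exact: Z_image.
have oZ : open (Z @^-1` U) by exact: open_preimage.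
exists (Z @^-1` U), (G \o Z); split=> //.
  move=> k; apply: (Ck_comp (A := U)) => //; first exact: has_coords_rV.
  exact: Z_smooth.
by move=> q Uq Sq; apply: (GE (Z q)) => //; exact: Z_image.
Qed.

Lemma smooth_fun_path_reparam (F : R -> M -> R) : smooth_fun_path X F ->
  smooth_fun_path X (fun t x => 'D_1 zeta t * F (zeta t) x).
Proof.
move=> sF c ac p Sp.
have [|U [G [oU Up CG GE]]] := sF c ac (Z p); first exact: Z_image.
have oZ : open (Z @^-1` U) by exact: open_preimage.
exists (Z @^-1` U), (((fun t : R => 'D_1 zeta t) \o fst) * (G \o Z)); split=> //.
  move=> k; apply: Ck_mul => //; last first.
    by apply: (Ck_comp_real (A := U)) => //; exact: Z_smooth.
  apply: (Ck_comp_real (A := setT)) => //.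
  - exact: has_coords_real.
  - exact: openT.
  - by have [_ /(_ 1)[]] := zeta_smooth k.+1.
  - by apply: Ck_linear => //; exact: continuous_linear_fst.
move=> q Uq Sq; have := GE (Z q) Uq (Z_image Sq).
by rewrite /= => ->.
Qed.

End Reparam.

Lemma smooth_fun_slice (F : R -> M -> R) (t : R) : smooth_fun_path X F ->
  0 <= t <= 1 -> smooth_fun X (F t).
Proof.
move=> sF t01 c ac k; have oc := image_open ac.
apply: Ck_local => u cu.
have [|U [G [oU Up CG GE]]] := sF c ac (t, u).
  by split; rewrite /= ?in_itv.
pose l (v : 'rV[R]_n) := (t, v).
have Cl m J : open J -> Ck m J l.
  by move=> oJ; apply: Ck_pair => //; [exact: Ck_cst|exact: Ck_id].
have cl : continuous l by move=> v; apply: Ck_continuous (Cl 0%N _ openT) _.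
have oJ : open (l @^-1` U `&` image_of c).
  by apply: openI => //; exact: open_preimage.
exists (l @^-1` U `&` image_of c) => //.
apply: (Ck_eq (f := G \o l)) => //.
  by move=> v [Uv cv]; apply/esym/(GE (t, v)).
apply: (Ck_comp_real (A := U)) => //.
- by apply: has_coords_prod; [exact: has_coords_real|exact: has_coords_rV].
- by move=> v [].
- exact: Cl.
Qed.

(** * Joint continuity in time and space *)

(** Continuity in the pair of time and point, relative to the times in the unit
    interval, outside of which a path is arbitrary. *)
Definition path_continuous (T : topologicalType) (f : R -> M -> T) : Prop :=
  forall (t : R) x N, 0 <= t <= 1 -> nbhs (f t x) N ->
    \forall p \near (t, x), 0 <= p.1 <= 1 -> N (f p.1 p.2).

Lemma near_dom c x : atlas X c -> dom c x -> \forall y \near x, dom c y.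
Proof.
by move=> ac cx; apply: open_nbhs_nbhs; split=> //; exact: (dom_open ac).
Qed.

Lemma cvg_time_coords c (t : R) x : atlas X c -> dom c x ->
  (fun p : R * M => (p.1, coords c p.2)) @ (t, x) --> (t, coords c x).
Proof.
move=> ac cx.
have l1 : (fun p : R * M => p.1) @ (t, x) --> t by exact: cvg_fst.
have l2 : (fun p : R * M => p.2) @ (t, x) --> x by exact: cvg_snd.
have l3 : (fun p : R * M => coords c p.2) @ (t, x) --> coords c x.
  exact: (cvg_comp _ _ l2 (coords_continuous ac cx)).
exact: (cvg_pair l1 l3).
Qed.

Lemma smooth_map_path_continuous phi :
  smooth_map_path X phi -> path_continuous phi.
Proof.
move=> sphi t x N t01 Nx; have [c ac cx] := atlas_cover X x.
have [c' [U [G [ac' oU Ut CG GE]]]] := smooth_map_path_coords sphi t01 ac cx.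
have [cG phiE] := GE t (coords c x) Ut t01 (image_coords cx).
rewrite (paramK ac)// in phiE.
have lim : (fun p : R * M => param c' (G (p.1, coords c p.2))) @ (t, x) -->
    phi t x.
  rewrite phiE; have := param_continuous ac' cG; apply: cvg_comp.
  have := Ck_continuous (CG 0%N) Ut; apply: cvg_comp.
  exact: cvg_time_coords.
have nU : \forall p \near (t, x), U (p.1, coords c p.2).
  exact: (cvg_time_coords ac cx) (open_nbhs_nbhs (conj oU Ut)).
have nc : \forall p \near (t, x), dom c p.2.
  exact: (cvg_snd (near_dom ac cx)).
near=> p => p01.
have cp : dom c p.2 by near: p.
have Up : U (p.1, coords c p.2) by near: p.
have [_] := GE _ _ Up p01 (image_coords cp).
rewrite (paramK ac)// => ->; near: p; exact: lim.
Unshelve. all: by end_near. Qed.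

Lemma smooth_fun_path_continuous (F : R -> M -> R) :
  smooth_fun_path X F -> path_continuous F.
Proof.
move=> sF t x N t01 Nx; have [c ac cx] := atlas_cover X x.
have [|U [G [oU Ut CG GE]]] := sF c ac (t, coords c x).
  by split; rewrite /= ?in_itv//; exact: image_coords.
have FE p : U (p.1, coords c p.2) -> 0 <= p.1 <= 1 -> dom c p.2 ->
    F p.1 p.2 = G (p.1, coords c p.2).
  move=> Up p01 cp; have := GE _ Up; rewrite /= (paramK ac)//; apply.
  by split; rewrite /= ?in_itv//; exact: image_coords.
have lim : (fun p : R * M => G (p.1, coords c p.2)) @ (t, x) --> F t x.
  rewrite (FE (t, x))//; have := Ck_continuous (CG 0%N) Ut; apply: cvg_comp.
  exact: cvg_time_coords.
have nU : \forall p \near (t, x), U (p.1, coords c p.2).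
  exact: (cvg_time_coords ac cx) (open_nbhs_nbhs (conj oU Ut)).
have nc : \forall p \near (t, x), dom c p.2.
  exact: (cvg_snd (near_dom ac cx)).
near=> p => p01.
have cp : dom c p.2 by near: p.
have Up : U (p.1, coords c p.2) by near: p.
rewrite FE//; near: p; exact: lim.
Unshelve. all: by end_near. Qed.

Section Velocity_form.
Variable eta : M -> @operator R M -> R.
Hypothesis eta_form : one_form X eta.

(** In a chart, the pairing is a sum of products of the coefficients of [eta]
    with derivatives of the coordinates.  For the distinguished point this is
    the continuity in time of the quantity [C_value]. *)
Lemma eta_velocity_continuous phi x : smooth_map_path X phi ->
  path_continuous
    (fun t (_ : M) => eta (phi t x) (velocity X `[0, 1] (phi^~ x) t)).
Proof.
move=> sphi t y N t01; have [lin_eta sm_eta] := eta_form.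
have [c [J [G [ac oJ Jt CG GE]]]] := path_coords x sphi t01.
pose g (s : R) := \sum_i 'D_1 G s 0 i * Defs.coef1 X eta c i (G s).
have etaE s : J s -> 0 <= s <= 1 ->
    eta (phi s x) (velocity X `[0, 1] (phi^~ x) s) = g s.
  move=> Js s01; rewrite (velocity_path_coords ac oJ CG GE)//.
  have [cG ->] := GE s Js s01.
  by rewrite (linear_on_coord_comb _ _ ac)//; exact: (dom_param ac).
have [cG _] := GE t Jt t01.
have cg : {for t, continuous g}.
  rewrite /prop_for /continuous_at /g.
  apply: cvg_finite_sum => i; apply: cvgM; last first.
    have := Ck_continuous (sm_eta c i ac 0%N) cG; apply: cvg_comp.
    exact: Ck_continuous (CG 0%N) Jt.
  have [_ /(_ 1)[_ [+ _]]] := CG 1%N => /(_ t Jt) D1c.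
  exact: (cvg_comp _ (fun v : 'rV[R]_n => v 0 i) D1c
    (@coord_continuous _ _ _ 0 i _)).
rewrite etaE// => Nt.
have gN : \forall s \near t, N (g s) by exact: cg.
have nJ : \forall s \near t, J s by apply: open_nbhs_nbhs.
near=> p => p01.
rewrite etaE//; last first.
  by near: p; exact: (cvg_fst nJ).
by near: p; exact: (cvg_fst gN).
Unshelve. all: by end_near. Qed.

End Velocity_form.

End Paths.

(** * Compactness arguments *)

Section Uniform.
Context {R : realType} {M : ptopologicalType}.
Hypothesis M_compact : compact [set: M].

Let cylinder_compact : compact (`[(0 : R), 1] `*` [set: M]).
Proof. by apply: compact_setX => //; exact: segment_compact. Qed.

(** A Lebesgue number argument on the compact cylinder: a relation between times
    that holds near each point holds at all points for all pairs of close
    times. *)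
Lemma uniform_in_time (Q : R -> R -> M -> Prop) :
  (forall (t : R) (x : M), 0 <= t <= 1 -> exists2 N, nbhs (t, x) N &
    forall (s s' : R) y, 0 <= s <= 1 -> 0 <= s' <= 1 ->
      N (s, y) -> N (s', y) -> Q s s' y) ->
  exists2 delta : R, 0 < delta & forall (s s' : R) y,
    0 <= s <= 1 -> 0 <= s' <= 1 -> `|s - s'| < delta -> Q s s' y.
Proof.
move=> loc; have /compact_near_coveringP/near_covering_withinP := cylinder_compact.
pose P (d : R) (p : R * M) := forall s', 0 <= s' <= 1 -> `|p.1 - s'| < d ->
  Q p.1 s' p.2.
move=> /(_ R 0^'+ P _) cov.
have near0 : \forall d \near 0^'+, `[(0 : R), 1] `*` [set: M] `<=` P d.
  apply: cov => -[t x] [/= + _]; rewrite in_itv/= => t01.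
  have [N [[A B] /= [At Bx] AB] NQ] := loc t x t01.
  move/nbhs_ballP : At => [r /= r0 rA].
  have r20 : 0 < r / 2 by rewrite divr_gt0.
  exists (ball t (r / 2) `*` B, [set d : R | d < r / 2]).
    split; last exact: nbhs_right_lt.
    by exists (ball t (r / 2), B) => //; split=> //; exact: nbhsx_ballx.
  move=> [[s y] d] /= [[ts By] dr] [/= + _]; rewrite in_itv/= => s01 s' s'01 ss'.
  apply: NQ => //; apply: AB; split=> //=; apply: rA.
    by apply: le_ball ts; lra.
  rewrite (splitr r); apply: ball_triangle ts _.
  by rewrite /ball/=; exact: lt_trans ss' dr.
have [d [d0 dP]] : exists d : R, 0 < d /\ `[(0 : R), 1] `*` [set: M] `<=` P d.
  apply: (@filter_ex _ (0 : R)^'+); near=> d; split; last by near: d.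
  by near: d; exact: nbhs_right_gt.
exists d => // s s' y s01 s'01 ss'.
by apply: (dP (s, y)) => //; split=> //=; rewrite in_itv.
Unshelve. all: by end_near. Qed.

Lemma path_bounded (F : R -> M -> R) : path_continuous F ->
  exists B : R, forall (t : R) x, 0 <= t <= 1 -> `|F t x| <= B.
Proof.
move=> cF; have /compact_near_coveringP/near_covering_withinP := cylinder_compact.
pose P (B : R) (p : R * M) := `|F p.1 p.2| <= B.
move=> /(_ R +oo P _) cov.
have nearoo : \forall B \near +oo, `[(0 : R), 1] `*` [set: M] `<=` P B.
  apply: cov => -[t x] [/= + _]; rewrite in_itv/= => t01.
  have := cF t x _ t01 (nbhsx_ballx (F t x) 1 ltr01) => N1.
  exists ([set p : R * M | 0 <= p.1 <= 1 -> ball (F t x) 1 (F p.1 p.2)],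
    [set B : R | `|F t x| + 1 < B]).
    by split=> //; exact: nbhs_pinfty_gt.
  move=> [[s y] B] /= [N BF] [/= + _]; rewrite in_itv/= => /N.
  rewrite /ball/= /P/= => FF; apply: le_trans (ltW BF).
  have -> : F s y = F t x - (F t x - F s y) by ring.
  by rewrite (le_trans (ler_normB _ _))// lerD2l ltW.
have [B BP] := @filter_ex _ (+oo : set_system R) _ _ nearoo.
exists B => t x t01; apply: (BP (t, x)); split=> //=; by rewrite in_itv.
Qed.

Lemma path_equicontinuous (F : R -> M -> R) (e : R) : path_continuous F ->
  0 < e -> exists2 delta : R, 0 < delta & forall (s s' : R) y,
    0 <= s <= 1 -> 0 <= s' <= 1 -> `|s - s'| < delta ->
    `|F s y - F s' y| <= e.
Proof.
move=> cF e0; apply: uniform_in_time => t x t01.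
have e20 : 0 < e / 2 by rewrite divr_gt0.
exists [set p : R * M | 0 <= p.1 <= 1 -> ball (F t x) (e / 2) (F p.1 p.2)].
  by apply: cF => //; exact: nbhsx_ballx.
move=> s s' y s01 s'01 /(_ s01) /= Ns /(_ s'01) /= Ns'.
rewrite ltW// [e]splitr.
exact: ball_triangle (ball_sym Ns) Ns'.
Qed.

(** If [x0] is the preimage of [y] at time [t], compactness keeps [phi] away
    from [y] on the complement of a neighbourhood of [x0], for all nearby times
    and targets; the preimages must then lie in the neighbourhood. *)
Lemma inverse_continuous (phi : R -> M -> M) : hausdorff_space M ->
  path_continuous phi ->
  (forall t : R, 0 <= t <= 1 ->
     injective (phi t) /\ forall y, phi t (inverse (phi t) y) = y) ->
  path_continuous (fun t => inverse (phi t)).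
Proof.
move=> hM cphi bij t y N t01 Nx.
have [inj surj] := bij t t01.
have : compact (~` N°).
  apply: (subclosed_compact _ M_compact) => //.
  exact/open_closedC/open_interior.
move=> /compact_near_coveringP/near_covering_withinP.
pose P (p : R * M) (x : M) := 0 <= p.1 <= 1 -> phi p.1 x <> p.2.
move=> /(_ _ (nbhs (t, y)) P _) cov.
have : \forall p \near (t, y), ~` N° `<=` P p.
  apply: cov => x nNx.
  have xy : phi t x != y.
    apply/eqP => E; apply: nNx; rewrite (_ : x = inverse (phi t) y)//.
    by apply: inj; rewrite surj.
  have := hM; rewrite open_hausdorff.
  move=> /(_ _ _ xy)[[A B] /= [xA yB] [oA oB /eqP AB]].
  have nA : nbhs (phi t x) A.
    by apply: open_nbhs_nbhs; split=> //; exact: set_mem.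
  have nB : nbhs y B by apply: open_nbhs_nbhs; split=> //; exact: set_mem.
  have [[T V] /= [Tt Vx] TV] := cphi t x A t01 nA.
  exists (V, T `*` B).
    by split=> //; exists (T, B).
  move=> [x' [s z]] /= [Vx' [Ts Bz]] _ s01 E.
  have := TV (s, x') (conj Ts Vx') s01; rewrite /= E => Az.
  by have : (A `&` B) z by []; rewrite AB.
apply: filterS => -[s z] /= NP s01.
have [_ surjs] := bij s s01.
apply: contrapT => nN; apply: (NP (inverse (phi s) z) _ s01 (surjs z)).
by move=> /interior_subset.
Qed.

End Uniform.

(** * Integral bounds and the Riemannian distance *)

Section Integral_bounds.
Context {R : realType}.

(** The integral of a nonnegative function is the supremum of the integrals of
    the simple functions below it, hence monotone for arbitrary integrands.
    This gives upper bounds for lengths of curves and for integrals of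
    oscillations without a study of the measurability of the integrand. *)
Lemma ge0_le_integral_lower d (T : measurableType d)
    (mu : {measure set T -> \bar R}) (D : set T) (f1 f2 : T -> \bar R) :
  (forall x, D x -> (0 <= f1 x)%E) -> (forall x, D x -> (f1 x <= f2 x)%E) ->
  (\int[mu]_(x in D) f1 x <= \int[mu]_(x in D) f2 x)%E.
Proof.
move=> f10 f12; rewrite !(integral_mkcond D).
have f20 x : D x -> (0 <= f2 x)%E.
  by move=> Dx; exact: le_trans (f10 x Dx) (f12 x Dx).
rewrite !ge0_integralTE; last 2 first.
- by move=> x; apply: erestrict_ge0 => y Dy; exact: f20.
- by move=> x; apply: erestrict_ge0 => y Dy; exact: f10.
apply: le_ereal_sup => _ [h /= hf <-]; exists h => //= x.
by apply: le_trans (hf x) _; apply: lee_restrict.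
Qed.

Lemma integral_unit_le_cst (f : R -> R) (C : R) :
  (forall t, 0 <= t <= 1 -> 0 <= f t <= C) ->
  (\int[lebesgue_measure]_(t in `[0%R, 1%R]) (f t)%:E <= C%:E)%E.
Proof.
move=> f0C.
apply: (@le_trans _ _ (\int[lebesgue_measure]_(t in `[0%R, 1%R]) (cst C%:E t))%E).
  by apply: ge0_le_integral_lower => t /=; rewrite in_itv/= => /f0C /andP[? ?];
     rewrite lee_fin.
rewrite integral_cst//= lebesgue_measure_itv/= lte_fin ltr01.
by rewrite oppr0 adde0 mule1.
Qed.

(** The integrand is dominated by [b] plus [D] times the indicators of the two
    end intervals, which is measurable and has an explicit integral. *)
Lemma integral_unit_le_ends (f : R -> R) (b D r : R) :
  0 <= b -> 0 <= D -> 0 < r ->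
  (forall t, 0 <= t <= 1 -> 0 <= f t <= b + D) ->
  (forall t, r < t < 1 - r -> f t <= b) ->
  (\int[lebesgue_measure]_(t in `[0%R, 1%R]) (f t)%:E <=
     (b + (D * r + D * r))%:E)%E.
Proof.
move=> b0 D0 r0 fD fb.
pose g t := (b + (D * \1_(`[0, r]) t + D * \1_(`[1 - r, 1]) t) : R)%:E.
have term0 (A : set R) t : (0 <= (D * \1_A t)%:E)%E.
  by rewrite lee_fin mulr_ge0.
have mterm (a c : R) :
    measurable_fun (`[0, 1] : set R) (EFin \o (fun t => D * \1_(`[a, c]) t)).
  by apply/measurable_EFinP; apply: measurable_funM.
have int_term (a c : R) : a <= c -> (\int[lebesgue_measure]_(t in `[0%R, 1%R])
    (D * \1_(`[a, c]) t)%:E <= (D * (c - a))%:E)%E.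
  move=> ac.
  under eq_integral do rewrite EFinM.
  rewrite ge0_integralZl//; last first.
    by apply/measurable_EFinP; exact: measurable_indic.
  rewrite integral_indic//.
  rewrite EFinM lee_wpmul2l ?lee_fin//.
  apply: (@le_trans _ _ (lebesgue_measure `[a, c])).
    by apply: le_measure; rewrite ?inE//; exact: measurableI.
  rewrite lebesgue_measure_itv/= lte_fin.
  by case: ifP => //; rewrite ?EFinB// lee_fin subr_ge0.
apply: (@le_trans _ _ (\int[lebesgue_measure]_(t in `[0%R, 1%R]) g t)%E).
  apply: ge0_le_integral_lower => t /=; rewrite in_itv/= => t01.
    by rewrite lee_fin; have /andP[] := fD t t01.
  have /andP[_ fDt] := fD t t01; rewrite lee_fin.
  have i0 (A : set R) : 0 <= D * \1_A t by rewrite mulr_ge0.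
  have i1 (A : set R) : A t -> D * \1_A t = D.
    by move=> At; rewrite indicE mem_set ?mulr1.
  have [tr|tr] := leP t r.
    apply: (le_trans fDt); rewrite lerD2l (i1 `[0, r]%classic)//; last first.
      by rewrite /= in_itv/= tr; case/andP: t01 => ->.
    by rewrite lerDl i0.
  have [tr'|tr'] := leP (1 - r) t.
    apply: (le_trans fDt); rewrite lerD2l (i1 `[1 - r, 1]%classic)//; last first.
      by rewrite /= in_itv/= tr'; case/andP: t01.
    by rewrite lerDr i0.
  apply: (le_trans (fb t _)); first by rewrite tr tr'.
  by rewrite lerDl addr_ge0 ?i0.
rewrite /g; under eq_integral do rewrite EFinD EFinD.
rewrite ge0_integralD//; last 2 first.
- by move=> t _; rewrite adde_ge0.
- by apply: emeasurable_funD; exact: mterm.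
rewrite ge0_integralD//; last 2 first.
- exact: mterm.
- exact: mterm.
rewrite EFinD EFinD leeD//.
  by apply: (@integral_unit_le_cst (cst b)) => t _; rewrite b0 lexx.
rewrite leeD//.
  by have := int_term 0 r (ltW r0); rewrite subr0.
have := int_term (1 - r) 1; rewrite opprB addrCA subrr addr0; apply.
by rewrite gerBl ltW.
Qed.

End Integral_bounds.

Section Distance.
Context {R : realType} {n : nat} {M : ptopologicalType}.
Variable X : smooth_manifold R n M.
Variable g : M -> @operator R M -> @operator R M -> R.
Hypothesis g_tensor : smooth_2tensor X g.

Lemma tensor_coord_comb c w x : atlas X c -> dom c x ->
  g x (coord_comb X c w x) (coord_comb X c w x) =
  \sum_j w 0 j * \sum_i w 0 i * Defs.coef2 X g c i j (coords c x).
Proof.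
move=> ac cx; have [bil _] := g_tensor.
have Tw := tangent_coord_comb w ac cx.
rewrite (linear_on_coord_comb _ (bil x _ Tw).1 ac cx).
apply: eq_bigr => j _; congr (_ * _).
have Tj := tangent_coord_vector j ac cx.
rewrite (linear_on_coord_comb _ (bil x _ Tj).2 ac cx).
by apply: eq_bigr => i _; rewrite /Defs.coef2 (paramK ac).
Qed.

Lemma rV_coord_le_norm (w : 'rV[R]_n) i : `|w 0 i| <= `|w|.
Proof.
rewrite [leRHS]/Num.Def.normr/= mx_normrE.
exact: (le_bigmax _ (fun ij : 'I_1 * 'I_n => `|w ij.1 ij.2|) (0, i)).
Qed.

Lemma tensor_coord_comb_le c w x (K d : R) : atlas X c -> dom c x ->
  `|w| <= d -> \sum_j \sum_i `|Defs.coef2 X g c i j (coords c x)| <= K ->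
  g x (coord_comb X c w x) (coord_comb X c w x) <= d * (d * K).
Proof.
move=> ac cx wd sK; rewrite tensor_coord_comb//.
have d0 : 0 <= d by exact: le_trans wd.
have wid i : `|w 0 i| <= d by exact: le_trans (rV_coord_le_norm w i) wd.
apply: le_trans (ler_norm _) _.
apply: le_trans (ler_norm_sum _ _ _) _.
apply: (@le_trans _ _ (d * (d * \sum_j \sum_i
    `|Defs.coef2 X g c i j (coords c x)|))); last by rewrite !ler_wpM2l.
rewrite !mulr_sumr; apply: ler_sum => j _; rewrite normrM.
rewrite ler_pM//; apply: le_trans (ler_norm_sum _ _ _) _.
rewrite mulr_sumr; apply: ler_sum => i _; rewrite normrM.
by rewrite ler_pM.
Qed.

Lemma segment_velocity c (u w : 'rV[R]_n) t : atlas X c -> 0 <= t <= 1 ->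
  (forall s, 0 <= s <= 1 -> image_of c (u + s *: w)) ->
  velocity X `[0, 1] (fun s => param c (u + s *: w)) t =
  coord_comb X c w (param c (u + t *: w)).
Proof.
move=> ac t01 seg.
apply: (velocity_coords (G := fun s => u + s *: w)) => //.
- exact: seg.
- by near=> s.
have D := is_deriveD (is_derive_cst u t 1) (is_derive_line (f := id) (v := w)
  (x := 0) (is_derive_id (t *: w + 0) w)).
rewrite add0r in D; move: D; congr (is_derive _ _ _ _).
by apply/funext => s; rewrite /= -[in RHS](addr0 (s *: w)).
Unshelve. all: by end_near. Qed.

Lemma segment_smooth c (u w : 'rV[R]_n) : atlas X c ->
  (forall s, 0 <= s <= 1 -> image_of c (u + s *: w)) ->
  @smooth_into R n M X R `[0, 1] (fun s : R => param c (u + s *: w)).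
Proof.
move=> ac seg p c' /= p01 ac' cp; rewrite in_itv/= in p01.
pose l (s : R) := u + s *: w.
have Cl k J : open J -> Ck k J l.
  move=> oJ; apply: (@Ck_add _ _ _ _ _ (cst u)) => //; first exact: Ck_cst.
  apply: (@Ck_linear _ _ _ _ _ (fun s : R => s *: w)) => //.
  split; last exact: scalel_continuous.
  by move=> a x y; rewrite scalerDl scalerA.
have cl : continuous l by move=> s; apply: Ck_continuous (Cl 0%N _ openT) _.
pose A := coords c @` (dom c `&` dom c').
have AE v : image_of c v -> dom c' (param c v) -> A v.
  move=> cv c'v; exists (param c v); last exact: (coords_paramK ac cv).
  by split=> //; exact: (dom_param ac).
have oA : open A.
  rewrite openE => v [x [cx c'x] <-]; rewrite /interior.
  have cv := image_coords cx.
  have nc : \forall z \near coords c x, image_of c z.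
    by apply: open_nbhs_nbhs; split=> //; exact: (image_open ac).
  have nc' : \forall z \near coords c x, dom c' (param c z).
    apply: (param_continuous ac cv); apply: (near_dom ac').
    by rewrite (paramK ac).
  by apply: filterS2 nc nc' => z; exact: AE.
have oU : open (l @^-1` A) by exact: open_preimage.
exists (l @^-1` A), ((coords c' \o param c) \o l); split=> //.
- by apply: AE => //; exact: seg.
- move=> k; apply: (Ck_comp (A := A)) => //; [exact: has_coords_rV..| |].
    exact: (transition_smooth ac ac').
  exact: Cl.
- move=> q [x [cx c'x] xE] q01; split=> //.
  by rewrite -[u + _ *: _]xE (paramK ac).
Qed.

(** A coordinate segment has constant velocity coordinates, so a bound on their
    length in the metric along the segment bounds the distance of its ends. *)
Lemma dist_segment_le c (u w : 'rV[R]_n) (e : R) : atlas X c -> 0 <= e ->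
  (forall s, 0 <= s <= 1 -> image_of c (u + s *: w) /\
    g (param c (u + s *: w)) (coord_comb X c w (param c (u + s *: w)))
      (coord_comb X c w (param c (u + s *: w))) <= e ^+ 2) ->
  (dist X g (param c u) (param c (u + w)) <= e%:E)%E.
Proof.
move=> ac e0 seg.
have segc s : 0 <= s <= 1 -> image_of c (u + s *: w) by move=> /seg[].
pose gam s := param c (u + s *: w).
apply: (@le_trans _ _ (curve_length X g gam)).
  apply: ereal_inf_lbound; exists gam => //; split.
  - exists [:: 1]; split=> //; first by rewrite /= ltr01.
    by case=> // _; exact: segment_smooth.
  - by rewrite /gam scale0r addr0.
  - by rewrite /gam scale1r.
apply: integral_unit_le_cst => t t01; rewrite sqrtr_ge0/=.
have [ct gt] := seg t t01.
rewrite segment_velocity// -(ger0_norm e0) -sqrtr_sqr.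
exact: ler_wsqrtr.
Qed.

(** The distance is compatible with the topology of the manifold: in a chart,
    the coefficients of [g] are bounded near [x], hence short coordinate
    segments have short length. *)
Lemma dist_small (x : M) (e : R) : 0 < e ->
  exists2 N, nbhs x N &
    forall y z, N y -> N z -> (dist X g y z <= e%:E)%E.
Proof.
move=> e0; have [c ac cx] := atlas_cover X x.
have [_ smooth_g] := g_tensor.
set u0 := coords c x; have cu0 : image_of c u0 by exact: image_coords.
pose s (u : 'rV[R]_n) := \sum_j \sum_i `|Defs.coef2 X g c i j u|.
have cs : s @ u0 --> s u0.
  apply: (@cvg_finite_sum _ _ (nbhs u0)) => j.
  apply: (@cvg_finite_sum _ _ (nbhs u0)) => i; apply: cvg_norm.
  exact: Ck_continuous (smooth_g c i j ac 0%N) cu0.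
have s0 u : 0 <= s u by rewrite !sumr_ge0// => j _; rewrite sumr_ge0.
pose K := s u0 + 1.
have K0 : 0 < K by rewrite ltr_wpDl.
have nK : \forall u \near u0, image_of c u /\ s u <= K.
  near=> u; split.
    by near: u; apply: open_nbhs_nbhs; split=> //; exact: (image_open ac).
  rewrite -lerBlDl; apply: le_trans (ler_norm _) _; rewrite distrC.
  by near: u; move/cvgrPdist_le : cs; apply.
move/nbhs_ballP : nK => [r /= r0 rP].
(* coordinate vectors of size at most [a] have [g]-length at most [e] *)
pose a := e / (K + 1).
have a0 : 0 < a by rewrite divr_gt0// addr_gt0.
have aK : a * (a * K) <= e ^+ 2.
  have -> : e = a * (K + 1) by rewrite /a divfK// gt_eqF// addr_gt0.
  rewrite exprMn expr2 -mulrA ler_wpM2l ?(ltW a0)// ler_wpM2l ?(ltW a0)//.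
  by rewrite sqrrD1; have := sqr_ge0 K; lra.
have [d [d0 dr da]] : exists d, [/\ 0 < d, d <= r & d <= a / 2].
  exists (Num.min r (a / 2)); split; last by rewrite ge_min lexx orbT.
    by rewrite lt_min r0 divr_gt0.
  by rewrite ge_min lexx.
exists [set y | dom c y /\ ball u0 d (coords c y)].
  have n1 := near_dom ac cx.
  have n2 : \forall y \near x, ball u0 d (coords c y).
    by apply: (coords_continuous ac cx); exact: nbhsx_ballx.
  exact: filterI n1 n2.
move=> y z [cy yd] [cz zd].
rewrite -(paramK ac cy) -(paramK ac cz).
set v := coords c y in yd *; set v' := coords c z in zd *.
rewrite -ball_normE/= in yd zd.
have -> : v' = v + (v' - v) by rewrite addrC subrK.
apply: dist_segment_le => //; first exact: ltW.
move=> t /andP[t0 t1].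
have bt : ball u0 r (v + t *: (v' - v)).
  rewrite -ball_normE/=; apply: lt_le_trans dr.
  have -> : u0 - (v + t *: (v' - v)) = (1 - t) *: (u0 - v) + t *: (u0 - v').
    by apply/rowP => i; rewrite !mxE; ring.
  apply: le_lt_trans (ler_normD _ _) _; rewrite !normrZ.
  rewrite (ger0_norm t0) (@ger0_norm _ (1 - t)) ?subr_ge0//.
  have [t2|t2] := leP t (1 / 2).
    have h1 : (1 - t) * `|u0 - v| < (1 - t) * d by rewrite ltr_pM2l//; lra.
    have h2 : t * `|u0 - v'| <= t * d by rewrite ler_wpM2l// ltW.
    have -> : d = (1 - t) * d + t * d by ring.
    exact: ltr_leD.
  have h1 : (1 - t) * `|u0 - v| <= (1 - t) * d.
    by rewrite ler_wpM2l ?subr_ge0// ltW.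
  have h2 : t * `|u0 - v'| < t * d by rewrite ltr_pM2l//; lra.
  have -> : d = (1 - t) * d + t * d by ring.
  exact: ler_ltD.
have [cv sK] := rP _ bt; split=> //.
apply: le_trans aK; apply: (tensor_coord_comb_le (c := c)) => //.
- exact: (dom_param ac).
- rewrite -(subrKA u0) -[v' - u0]opprB.
  apply: le_trans (ler_normD _ _) _; rewrite normrN [a]splitr lerD//.
    exact: le_trans (ltW zd) da.
  exact: le_trans (ltW yd) da.
- by rewrite (coords_paramK ac).
Unshelve. all: by end_near. Qed.

End Distance.

(** * Reparametrizing a co-Hamiltonian isotopy *)

Lemma osc_bounds (R : realType) (M : ptopologicalType) (f : M -> R) (b : R) :
  (forall x, `|f x| <= b) -> 0 <= osc f <= b + b.
Proof.
move=> fb.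
have ne : range f !=set0 by exists (f point), point.
have fub : ubound (range f) b.
  by move=> _ [x _ <-]; have := fb x; rewrite ler_norml => /andP[].
have flb : lbound (range f) (- b).
  by move=> _ [x _ <-]; have := fb x; rewrite ler_norml => /andP[].
have s1 : sup (range f) <= b by exact: ge_sup.
have i1 : - b <= inf (range f) by exact: lb_le_inf.
have s2 : f point <= sup (range f).
  by apply: ub_le_sup; [exists b|exists point].
have i2 : inf (range f) <= f point.
  by apply: ge_inf; [exists (- b)|exists point].
by rewrite /osc; apply/andP; split; lra.
Qed.

Section Reparametrized_isotopy.
Context {R : realType} {n : nat} {M : ptopologicalType}.
Variable X : smooth_manifold R n M.
Variables (eta : M -> @operator R M -> R)
  (omega : M -> @operator R M -> @operator R M -> R).
Hypothesis eta_omega : cosymplectic X eta omega.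
Variables (phi : R -> M -> M) (F : R -> M -> R).
Hypothesis phi_F : coHamiltonian X eta omega phi F.

Let eta_form : one_form X eta. Proof. by have [[]] := eta_omega. Qed.

Lemma coHamiltonian_smooth : smooth_map_path X phi.
Proof. by have [[]] := phi_F. Qed.

Lemma coHamiltonian_bij (t : R) : 0 <= t <= 1 ->
  injective (phi t) /\ forall y, phi t (inverse (phi t) y) = y.
Proof.
move=> t01; have [[_ _ /(_ t t01)[[_ [h [_ hK Kh]]] _ _]] _ _] := phi_F.
split; first exact: can_inj hK.
by move=> y; apply: (@getPex _ [set x | phi t x = y]); exists (h y); exact: Kh.
Qed.

Lemma tangent_path_velocity (t : R) y : 0 <= t <= 1 ->
  tangent X y (path_velocity X phi t y).
Proof.
move=> t01; have [_ surj] := coHamiltonian_bij t01.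
by have := tangent_velocity (inverse (phi t) y) coHamiltonian_smooth t01;
   rewrite surj.
Qed.

Lemma C_valueE (t : R) : 0 <= t <= 1 -> C_value X eta phi t =
  eta (phi t point) (velocity X `[0, 1] (phi^~ point) t).
Proof.
move=> t01; have [inj surj] := coHamiltonian_bij t01.
rewrite /C_value /C_fun /path_velocity.
by have -> : inverse (phi t) (phi t point) = point by apply: inj; rewrite surj.
Qed.

Section Zeta.
Variable zeta : R -> R.
Hypotheses (zeta_smooth : Cinfty setT zeta)
  (zeta0 : zeta 0 = 0)
  (zeta01 : forall t : R, 0 <= t <= 1 -> 0 <= zeta t <= 1).

Lemma C_value_reparam (t : R) : 0 <= t <= 1 ->
  C_value X eta (fun s => phi (zeta s)) t =
  'D_1 zeta t * C_value X eta phi (zeta t).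
Proof.
move=> t01; have [lin_eta _] := eta_form.
rewrite /C_value /C_fun (path_velocity_reparam zeta_smooth zeta01)//; last first.
  exact: coHamiltonian_smooth.
rewrite (linear_onZ _ (lin_eta _))//; apply: tangent_path_velocity.
exact: zeta01.
Qed.

(** Both [I_map] in its first tangent argument and a tangent vector, as a
    derivation, are linear, so the factor [zeta'] of the velocity passes to the
    Hamiltonian. *)
Lemma coHamiltonian_reparam : coHamiltonian X eta omega
  (fun t => phi (zeta t)) (fun t x => 'D_1 zeta t * F (zeta t) x).
Proof.
have [[sphi phi0 phiP] sF HF] := phi_F; split.
- split; first exact: smooth_map_path_reparam.
    by rewrite zeta0.
  by move=> t /zeta01; exact: phiP.
- exact: smooth_fun_path_reparam.
move=> t y Z t01 TZ; have z01 := zeta01 t01.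
rewrite (path_velocity_reparam zeta_smooth zeta01)// /differential.
have TY := tangent_path_velocity y z01.
have [_ [[[bil _] _] _] _] := eta_omega; have [lin_eta _] := eta_form.
rewrite (tangent_funZ _ TZ (smooth_fun_slice sF z01)).
have <- : I_map eta omega y (path_velocity X phi (zeta t) y) Z = Z (F (zeta t)).
  exact: HF.
rewrite /I_map (linear_onZ _ (lin_eta y))//.
by rewrite (linear_onZ (alpha := omega y ^~ Z) _ (bil y Z TZ).2)//; ring.
Qed.

End Zeta.

Hypothesis M_compact : compact [set: M].

Lemma C_value_path_continuous :
  path_continuous (fun t (_ : M) => eta (phi t point)
    (velocity X `[0, 1] (phi^~ point) t)).
Proof. exact: eta_velocity_continuous coHamiltonian_smooth. Qed.

Section Distance.
Variable g : M -> @operator R M -> @operator R M -> R.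
Hypothesis g_tensor : smooth_2tensor X g.

(** [dist_small] at [f t x] and the joint continuity of [f] give the local
    hypothesis of [uniform_in_time]. *)
Lemma path_dist_equicontinuous (f : R -> M -> M) (e : R) :
  path_continuous f -> 0 < e ->
  exists2 delta : R, 0 < delta & forall (s s' : R) y,
    0 <= s <= 1 -> 0 <= s' <= 1 -> `|s - s'| < delta ->
    (dist X g (f s y) (f s' y) <= e%:E)%E.
Proof.
move=> cf e0.
apply: (uniform_in_time M_compact
  (Q := fun s s' y => (dist X g (f s y) (f s' y) <= e%:E)%E)) => t x t01.
have [N Nx ND] := dist_small g_tensor (f t x) e0.
exists [set p : R * M | 0 <= p.1 <= 1 -> N (f p.1 p.2)]; first exact: cf.
by move=> s s' y s01 s'01 Ns Ns'; apply: ND; [exact: Ns|exact: Ns'].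
Qed.

(** Applies [path_dist_equicontinuous] to [phi] and to the path of its inverses,
    as the distance compares both the maps and their inverses. *)
Lemma d_bar_reparam_le (e : R) : 0 < e ->
  exists2 delta : R, 0 < delta & forall zeta : R -> R,
    (forall t : R, 0 <= t <= 1 ->
      0 <= zeta t <= 1 /\ `|zeta t - t| < delta) ->
    (d_bar X g (fun t => phi (zeta t)) phi <= e%:E)%E.
Proof.
move=> e0; have cphi := smooth_map_path_continuous coHamiltonian_smooth.
have cinv : path_continuous (fun t => inverse (phi t)).
  apply: inverse_continuous => //; first exact: (manifold_hausdorff X).
  exact: coHamiltonian_bij.
have [d1 d10 D1] := path_dist_equicontinuous cphi e0.
have [d2 d20 D2] := path_dist_equicontinuous cinv e0.
exists (Num.min d1 d2); first by rewrite lt_min d10.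
move=> zeta zetaP; apply: ub_ereal_sup => _ [t /= + <-].
rewrite in_itv/= => t01; have [z01] := zetaP t t01.
rewrite lt_min => /andP[zd1 zd2].
rewrite /d_0 ge_max; apply/andP; split; apply: ub_ereal_sup => _ [x _ <-].
  exact: D1.
exact: (D2 (zeta t) t).
Qed.

End Distance.

(** The integrand is at most [e / 2] where [zeta' = 1], by uniform continuity in
    time of [F] and of [C_value].  Near the ends it is bounded by a constant
    [D] which depends on [K] but not on [delta], and these ends have total
    length at most [4 * delta]. *)
Lemma D_CH_reparam_lt (K e : R) : 0 <= K -> 0 < e ->
  exists2 delta0 : R, 0 < delta0 & forall (delta : R) (zeta : R -> R),
    0 < delta -> delta < delta0 -> Cinfty setT zeta ->
    (forall t : R, 0 <= t <= 1 ->
      [/\ 0 <= zeta t <= 1, `|zeta t - t| <= 2 * delta & `|'D_1 zeta t| <= K]) ->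
    (forall t : R, 2 * delta < t < 1 - 2 * delta -> 'D_1 zeta t = 1) ->
    (D_CH X eta phi F (fun t => phi (zeta t))
       (fun t x => 'D_1 zeta t * F (zeta t) x)%R < e%:E)%E.
Proof.
move=> K0 e0; have [_ sF _] := phi_F.
have cF := smooth_fun_path_continuous sF.
have [B FB] := path_bounded M_compact cF.
have [BC CB] := path_bounded M_compact C_value_path_continuous.
have e60 : 0 < e / 6 by rewrite divr_gt0.
have [d1 d10 D1] := path_equicontinuous M_compact cF e60.
have [d2 d20 D2] := path_equicontinuous M_compact C_value_path_continuous e60.
have B0 : 0 <= B.
  by apply: le_trans (FB 0 point _); rewrite // lexx ler01.
have BC0 : 0 <= BC.
  by apply: le_trans (CB 0 point _); rewrite // lexx ler01.
pose D := (B + K * B) + (B + K * B) + (BC + K * BC).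
have D0 : 0 <= D by rewrite !addr_ge0// mulr_ge0.
have [d0 [d00 dd1 dd2 dD]] : exists d0 : R,
    [/\ 0 < d0, 2 * d0 <= d1, 2 * d0 <= d2 & 8 * (D + 1) * d0 <= e].
  exists (Num.min (Num.min (d1 / 2) (d2 / 2)) (e / (8 * (D + 1)))); split.
  - by rewrite !lt_min !divr_gt0// mulr_gt0// ltr_wpDl.
  - rewrite mulrC -ler_pdivlMr// ge_min ge_min lexx //.
  - by rewrite mulrC -ler_pdivlMr// ge_min ge_min lexx orbT.
  - by rewrite mulrC -ler_pdivlMr ?ge_min ?lexx ?orbT// mulr_gt0// ltr_wpDl.
exists d0 => // d zeta d_gt0 dd0 sz zP z1.
have zeta01 t : 0 <= t <= 1 -> 0 <= zeta t <= 1 by move=> /zP[].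
pose f t := osc (fun x => F t x - 'D_1 zeta t * F (zeta t) x) +
  `|C_value X eta phi t - C_value X eta (fun t => phi (zeta t)) t|.
have fE t : 0 <= t <= 1 -> f t =
    osc (fun x => F t x - 'D_1 zeta t * F (zeta t) x) +
    `|C_value X eta phi t - 'D_1 zeta t * C_value X eta phi (zeta t)|.
  by move=> t01; rewrite /f (C_value_reparam sz zeta01).
have diff_le (u v a b : R) : `|u| <= b -> `|v| <= b -> `|a| <= K ->
    `|u - a * v| <= b + K * b.
  move=> ub vb aK; rewrite (le_trans (ler_normB _ _))// lerD// normrM.
  exact: ler_pM.
have fD t : 0 <= t <= 1 -> 0 <= f t <= e / 2 + D.
  move=> t01; have [z01 _ zK] := zP t t01; rewrite fE//.
  have /andP[osc_ge osc_le] := @osc_bounds _ _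
    (fun x => F t x - 'D_1 zeta t * F (zeta t) x)
    _ (fun x => diff_le _ _ _ _ (FB t x t01) (FB (zeta t) x z01) zK).
  have c1 : `|C_value X eta phi t - 'D_1 zeta t * C_value X eta phi (zeta t)|
      <= BC + K * BC.
    by apply: diff_le => //; rewrite C_valueE//; [exact: (CB _ point)..].
  rewrite addr_ge0//=.
  apply: (@le_trans _ _ D); first by rewrite lerD.
  by rewrite lerDr divr_ge0// ltW.
have fb t : 2 * d < t < 1 - 2 * d -> f t <= e / 2.
  move=> tmid; have t01 : 0 <= t <= 1.
    by case/andP: tmid => ? ?; apply/andP; split; lra.
  have [z01 zd _] := zP t t01; rewrite fE// z1// mul1r.
  have zd1 : `|t - zeta t| < d1 by rewrite distrC; lra.
  have zd2 : `|t - zeta t| < d2 by rewrite distrC; lra.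
  have /andP[_ osc_le] := @osc_bounds _ _
    (fun x => F t x - 1 * F (zeta t) x) (e / 6)
    ltac:(by move=> x; rewrite /= mul1r D1).
  have c1 : `|C_value X eta phi t - C_value X eta phi (zeta t)| <= e / 6.
    by rewrite !C_valueE//; exact: (D2 _ _ point).
  lra.
apply: (@le_lt_trans _ _ (e / 2 + (D * (2 * d) + D * (2 * d)))%:E).
  apply: integral_unit_le_ends => //; rewrite ?divr_ge0 ?mulr_gt0// ltW//.
rewrite lte_fin.
have : (D + 1) * d < (D + 1) * d0 by rewrite ltr_pM2l// ltr_wpDl.
lra.
Qed.

End Reparametrized_isotopy.

Theorem lemma3p3 (R : realType) (n : nat) (M : ptopologicalType)
  (X : smooth_manifold R n M)
  (M_compact : compact [set: M]) (M_connected : connected [set: M])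
  (eta : M -> operator -> R) (omega : M -> operator -> operator -> R)
  (eta_omega : cosymplectic X eta omega)
  (g : M -> operator -> operator -> R) (g_metric : riemannian_metric X g)
  (phi : R -> M -> M) (F : R -> M -> R)
  (phi_F : coHamiltonian X eta omega phi F)
  (eps : R) (eps_gt0 : 0 < eps) :
  exists (psi : R -> M -> M) (H : R -> M -> R),
    [/\ coHamiltonian X eta omega psi H /\ boundary_flat H,
        phi 0 = psi 0 /\ phi 1 = psi 1,
        (D_CH X eta phi F psi H < eps%:E)%E &
        (d_bar X g psi phi < eps%:E)%E].
Proof.
have [K K0 reparam] := @smooth_reparametrization R.
have [d1 d10 D1] := D_CH_reparam_lt eta_omega phi_F M_compact K0 eps_gt0.
have e20 : 0 < eps / 2 by rewrite divr_gt0.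
have [g_tensor _ _] := g_metric.
have [d2 d20 D2] := d_bar_reparam_le phi_F M_compact g_tensor e20.
have [d [d0 dd1 dd2 d4]] :
    exists d : R, [/\ 0 < d, d < d1, 2 * d < d2 & d < 1 / 4].
  (* the factor 5 leaves room for the strict bounds on [2 * d] and [4 * d] *)
  exists (Num.min (Num.min d1 d2) 1 / 5).
  have m0 : 0 < Num.min (Num.min d1 d2) 1 by rewrite !lt_min d10 d20 ltr01.
  have m1 : Num.min (Num.min d1 d2) 1 <= d1 by rewrite !ge_min lexx.
  have m2 : Num.min (Num.min d1 d2) 1 <= d2 by rewrite !ge_min lexx orbT.
  have m3 : Num.min (Num.min d1 d2) 1 <= 1 by rewrite !ge_min lexx orbT.
  by move: m0 m1 m2 m3; set m := Num.min _ _ => *; split; lra.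
have [zeta [sz [z0 z1] zP zmid zend]] := reparam d d0 d4.
have z01 t : 0 <= t <= 1 -> 0 <= zeta t <= 1 by move=> /zP[].
exists (fun t => phi (zeta t)), (fun t x => 'D_1 zeta t * F (zeta t) x).
split.
- split; first exact: coHamiltonian_reparam.
  exists d; split; first by apply/andP; split; lra.
  move=> t x; rewrite !in_itv/= => td; rewrite zend ?mul0r//.
  by case/orP: td => /andP[? ?]; [left|right].
- by rewrite z0 z1.
- exact: (D1 d).
- apply: (@le_lt_trans _ _ (eps / 2)%:E); last by rewrite lte_fin; lra.
  apply: D2 => t t01; have [zt dt _] := zP t t01; split=> //.
  exact: le_lt_trans dt dd2.
Qed.
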